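(* Let $G$ be a regular Lie groupoid over a smooth manifold $M$. Then $G$ fits into an extension $$I(G)^{\circ}\xrightarrow{\ j\ } G\xrightarrow{\ \pi\ } E$$ of groupoids over $M$, where $I(G)^{\circ}$ (the union over $x\in M$ of the identity components of the isotropy groups of $G$) is a bundle of connected Lie groups over $M$, $E$ is a foliation groupoid over $M$, $j$ and $\pi$ are homomorphisms of Lie groupoids, $j$ is an embedding, and $\pi$ is a submersion with connected fibers.
   Context: A Lie groupoid $G$ over a smooth (Hausdorff) manifold $M$ has a manifold of arrows $G$ (possibly non-Hausdorff), submersions $s,t:G\to M$ (source and target), and smooth composition, unit and inverse maps; $g:x\to y$ means $s(g)=x$, $t(g)=y$. $G$ is regular if for each $x\in M$ the map $t:s^{-1}(x)\to M$ has constant rank, this rank being (locally) constant in $x$; equivalently, the anchor map of its Lie algebroid has locally constant rank. $G$ is a foliation groupoid if the fibers of $(s,t):G\to M\times M$ are discrete. A bundle of Lie groups over $M$ is a Lie groupoid over $M$ with $s=t$. For $x\in M$, $I(G)_x$ is the Lie group of arrows $x\to x$ in $G$, $I(G)_x^{\circ}$ is its identity component, $I(G)^\circ=\bigcup_{x\in M} I(G)_x^{\circ}\subset G$, and $j$ is the inclusion. ''Extension'' $K\xrightarrow{j}G\xrightarrow{\pi}E$ of groupoids over $M$ means: $j$ and $\pi$ are homomorphisms of Lie groupoids which are the identity on $M$, $\pi$ is surjective, and $j$ identifies $K$ with the kernel of $\pi$, i.e. the arrows of $G$ sent by $\pi$ to unit arrows. *)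

(* Defs.v *)
From HB Require Import structures.
From mathcomp Require Import all_boot all_order all_algebra.
From mathcomp Require Import all_classical all_reals all_analysis.

Set Implicit Arguments.
Unset Strict Implicit.
Unset Printing Implicit Defensive.

Import Order.TTheory GRing.Theory Num.Theory.
Import numFieldNormedType.Exports.
Local Open Scope classical_set_scope.
Local Open Scope ring_scope.

(** Smooth maps between open subsets of Euclidean spaces *)

(* Meant for open U: then only the values of the total function f on U matter. *)
Fixpoint Ck_on (R : realType) (n m k : nat) (U : set 'rV[R]_n)
    (f : 'rV[R]_n -> 'rV[R]_m) : Prop :=
  match k with
  | 0%N => forall v, U v -> {for v, continuous f}
  | k'.+1 => (forall v, U v -> differentiable f v) /\
             (forall w, Ck_on k' U (fun v => 'D_w f v))
  end.

Definition smooth_on (R : realType) (n m : nat) (U : set 'rV[R]_n)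
    (f : 'rV[R]_n -> 'rV[R]_m) : Prop :=
  forall k, Ck_on k U f.

(** Charts and manifolds *)

(* cinv is total, but only its values on the open set cfun @` cdom matter. *)
Record chart (R : realType) (T : topologicalType) := Chart {
  cdim : nat;
  cdom : set T;
  cfun : T -> 'rV[R]_cdim;
  cinv : 'rV[R]_cdim -> T }.

Arguments cdim {R T} c.
Arguments cdom {R T} c.
Arguments cfun {R T} c.
Arguments cinv {R T} c.

Definition is_chart (R : realType) (T : topologicalType) (c : chart R T) :
    Prop :=
  [/\ open (cdom c),
      open (cfun c @` cdom c),
      forall x, cdom c x -> cinv c (cfun c x) = x,
      forall x, cdom c x -> {for x, continuous (cfun c)} &
      forall v, (cfun c @` cdom c) v -> {for v, continuous (cinv c)}].

Record chartedSpace (R : realType) := ChartedSpace {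
  points :> topologicalType;
  atlas : set (chart R points) }.

Arguments atlas {R} X _ : rename.

Section LocalExpressions.
Context {R : realType} {S T : topologicalType}.
Implicit Types (c : chart R S) (d : chart R T) (f : S -> T).

Definition rep_dom c d f : set 'rV[R]_(cdim c) :=
  cfun c @` (cdom c `&` f @^-1` cdom d).
Arguments rep_dom : clear implicits.

Definition local_rep c d f : 'rV[R]_(cdim c) -> 'rV[R]_(cdim d) :=
  cfun d \o f \o cinv c.
Arguments local_rep : clear implicits.

Definition smooth_rep c d f : Prop :=
  smooth_on (rep_dom c d f) (local_rep c d f).

Definition rank_rep c d f (x : S) : nat :=
  \rank ('J (local_rep c d f) (cfun c x)).

End LocalExpressions.

Arguments rep_dom {R S T} c d f _.
Arguments local_rep {R S T} c d f _.

(* Smooth manifolds, without any separation or countability axiom.  The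
   dimension is locally constant only: when the rank of a regular groupoid is
   not globally constant, I(G)° and E have components of different
   dimensions. *)
Definition is_manifold (R : realType) (X : chartedSpace R) : Prop :=
  [/\ forall c, atlas X c -> is_chart c,
      forall x : X, exists2 c, atlas X c & cdom c x &
      forall c d, atlas X c -> atlas X d -> smooth_rep c d id].

Section SmoothMaps.
Context {R : realType} {X Y : chartedSpace R}.
Implicit Type f : X -> Y.

Definition smooth f : Prop :=
  continuous f /\
  forall c d, atlas X c -> atlas Y d -> smooth_rep c d f.

Definition has_rank_at f (x : X) (r : nat) : Prop :=
  forall c d, atlas X c -> atlas Y d -> cdom c x -> cdom d (f x) ->
  rank_rep c d f x = r.

Definition submersion f : Prop :=
  smooth f /\
  forall c d x, atlas X c -> atlas Y d -> cdom c x -> cdom d (f x) ->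
  rank_rep c d f x = cdim d.

Definition immersion f : Prop :=
  smooth f /\
  forall c d x, atlas X c -> atlas Y d -> cdom c x -> cdom d (f x) ->
  rank_rep c d f x = cdim c.

Definition embedding f : Prop :=
  [/\ immersion f, injective f &
      forall U : set X, open U ->
      exists2 V : set Y, open V & f @` U = V `&` range f].

End SmoothMaps.

Section Products.
Context {R : realType}.

Definition prod_chart (S T : topologicalType) (c : chart R S)
    (d : chart R T) : chart R (S * T)%type :=
  Chart (cdim := cdim c + cdim d)
    (cdom c `*` cdom d)
    (fun p => row_mx (cfun c p.1) (cfun d p.2))
    (fun v => (cinv c (lsubmx v), cinv d (rsubmx v))).

Definition prod_space (X Y : chartedSpace R) : chartedSpace R :=
  ChartedSpace [set e | exists c d,
    [/\ atlas X c, atlas Y d & e = prod_chart c d]].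

(* The submanifold structure on a subset A, with the subspace topology: its
   charts are all the charts of the topological space A in which the inclusion
   A -> X is a smooth immersion.  A is an embedded submanifold of X exactly when
   these charts cover A. *)
Definition sub_space (X : chartedSpace R) (A : set X) : chartedSpace R :=
  @ChartedSpace R (set_type A : topologicalType) [set c | is_chart c /\
    forall d, atlas X d ->
      smooth_rep c d (@set_val X A) /\
      forall x : set_type A, cdom c x -> cdom d (set_val x) ->
        rank_rep c d (@set_val X A) x = cdim c].

End Products.

(** Lie groupoids *)

Definition composable (R : realType) (M G : chartedSpace R) (s t : G -> M) :
    set (prod_space G G) :=
  [set p | s p.1 = t p.2].

(* The product [gcomp h g] is g followed by h; it is meaningful only if
   [src h = tgt g].  The arrows form a possibly non-Hausdorff manifold. *)
Record lieGroupoid (R : realType) (M : chartedSpace R) := LieGroupoid {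
  arrows :> chartedSpace R;
  src : arrows -> M;
  tgt : arrows -> M;
  gcomp : arrows -> arrows -> arrows;
  gunit : M -> arrows;
  ginv : arrows -> arrows;
  arrows_manifold : is_manifold arrows;
  src_submersion : submersion src;
  tgt_submersion : submersion tgt;
  (* the fibre product is an embedded submanifold since src is a submersion *)
  gcomp_smooth :
    @smooth R (sub_space (composable src tgt)) arrows
      (fun p => gcomp (set_val p).1 (set_val p).2);
  gunit_smooth : smooth gunit;
  ginv_smooth : smooth ginv;
  src_gcomp : forall h g, src h = tgt g -> src (gcomp h g) = src g;
  tgt_gcomp : forall h g, src h = tgt g -> tgt (gcomp h g) = tgt h;
  gcompA : forall k h g, src k = tgt h -> src h = tgt g ->
    gcomp k (gcomp h g) = gcomp (gcomp k h) g;
  src_gunit : forall x, src (gunit x) = x;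
  tgt_gunit : forall x, tgt (gunit x) = x;
  gcomp1g : forall g, gcomp (gunit (tgt g)) g = g;
  gcompg1 : forall g, gcomp g (gunit (src g)) = g;
  src_ginv : forall g, src (ginv g) = tgt g;
  tgt_ginv : forall g, tgt (ginv g) = src g;
  gcompVg : forall g, gcomp (ginv g) g = gunit (src g);
  gcompgV : forall g, gcomp g (ginv g) = gunit (tgt g) }.

Section GroupoidNotions.
Context {R : realType} {M : chartedSpace R}.
Implicit Types G K E : lieGroupoid M.

Definition src_fiber G (x : M) : set G := [set g | src g = x].
Arguments src_fiber : clear implicits.

Definition regular G : Prop :=
  exists r : M -> nat,
    (forall x : M, \forall y \near x, r y = r x) /\
    (forall (x : M) (g : sub_space (src_fiber G x)),
      @has_rank_at R (sub_space (src_fiber G x)) M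
        (fun h => tgt (set_val h)) g (r x)).

Definition foliation_groupoid E : Prop :=
  forall x y : M, let F := [set g : E | src g = x /\ tgt g = y] in
  F `<=` isolated F.

Definition bundle_of_Lie_groups K : Prop := forall g : K, src g = tgt g.

Definition isotropy G (x : M) : set G := [set g | src g = x /\ tgt g = x].
Arguments isotropy : clear implicits.

Definition isotropy_id_component G : set G :=
  \bigcup_x connected_component (isotropy G x) (gunit G x).

Definition groupoid_hom G E (f : G -> E) : Prop :=
  [/\ smooth f,
      forall g, src (f g) = src g,
      forall g, tgt (f g) = tgt g,
      forall x, f (gunit G x) = gunit E x &
      forall h g : G, src h = tgt g -> f (gcomp h g) = gcomp (f h) (f g)].

Definition groupoid_kernel G E (f : G -> E) : set G :=
  [set g | exists x, f g = gunit E x].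

Definition extension K G E (j : K -> G) (p : G -> E) : Prop :=
  [/\ groupoid_hom j, groupoid_hom p, range p = setT, injective j &
      range j = groupoid_kernel p].

End GroupoidNotions.

Arguments src_fiber {R M} G x _.
Arguments isotropy {R M} G x _.
Arguments isotropy_id_component {R M} G _.
Arguments second_countable : clear implicits.

(* Main.v *)
Require Import Defs.
From HB Require Import structures.
From mathcomp Require Import all_boot all_order all_algebra.
From mathcomp Require Import all_classical all_reals all_analysis.
From mathcomp Require Import zify ring lra.
Import Order.TTheory GRing.Theory Num.Theory.
Import numFieldNormedType.Exports.
Local Open Scope classical_set_scope.
Local Open Scope ring_scope.

Set Implicit Arguments.
Unset Strict Implicit.
Unset Printing Implicit Defensive.

(** The anchor F = (s, t) : G -> M x M of a regular groupoid has locally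
    constant rank: at g it is dim M plus the rank of t on the source fibre
    through g, because the tangent space of that fibre is the kernel of ds.  By
    the constant rank theorem every arrow has a neighbourhood (a flow box) that
    is a product of a transversal, on which F is injective, and a plaque, on
    which F is constant.  E is the quotient of G by the connected components of
    the fibres of F.  As F separates the plaques of a flow box, each leaf meets
    a flow box in at most one plaque, so the transversals are charts of E and E
    is a manifold on which F is locally injective.  Composition and inversion
    map leaves to leaves, so E is a groupoid; the fibres of its (s, t) are
    discrete by this local injectivity.  The kernel of G -> E is the set of arrows lying in
    the leaf of a unit, which is I(G)^0; it is the preimage under a submersion
    of the image of the unit section M -> E, hence an embedded submanifold. *)

(** * C^k calculus in coordinates *)

(** Why components: the quotient of G by the whole fibres of F has neither connected fibres nor, in
    general, a manifold structure. For the reflection of the line, the action groupoid has constant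
    rank but the image of F is a cross. Passing to components usually costs holonomy arguments; here
    they are avoided by one choice. The transverse coordinate of a flow box has the form [u (f x)],
    a function of the value of F alone. Two points of one leaf have the same value under F, so a
    change of charts of E is computed in M x M, without following the leaf from one box to another.
    No separation of G enters. Ranks are met only twice: in the constant rank theorem and in the
    computation of the rank of F. Elsewhere a submersion is used through its smooth local sections.
    They test smoothness of maps out of E by composing with the projection, lift composable pairs of
    E to composable pairs of G, and produce the charts of submanifolds such as the composable pairs,
    the source fibres and I(G)^0. *)

Lemma near_all (T : topologicalType) (x : T) (P : T -> Prop) :
  (forall y, P y) -> \forall y \near x, P y.
Proof. by move=> HP; apply: nearW. Qed.

(** * Continuity and differentials depend only on germs *)

Section Congruence.
Context {R : realType}.

Lemma continuous_near_eq (S T : topologicalType) (f g : S -> T) (x : S) :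
  (\near x, f x = g x) -> {for x, continuous f} -> {for x, continuous g}.
Proof.
move=> fg cf; rewrite /prop_for /continuous_at -(nbhs_singleton fg).
apply: cvg_trans cf; apply: near_eq_cvg.
by apply: filterS fg.
Qed.

Context {V W : normedModType R}.
Implicit Types f g : V -> W.

Lemma differentiable_littleo f (x : V) : differentiable f x ->
  forall e, 0 < e -> \forall h \near (0 : V),
    `|f (h + x) - f x - 'd f x h| <= e * `|h|.
Proof.
move=> /diff_locally /eqaddoP + e e0 => /(_ e e0).
by apply: filterS => h /=; rewrite opprD addrA.
Qed.

(** Reads off a differential from an epsilon estimate; this is how the differentials of an inverse
    map and of a map known only near a point are computed. *)
Lemma is_diff_littleo f (df : {linear V -> W}) (x : V) : continuous df ->
  (forall e, 0 < e -> \forall h \near (0 : V),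
    `|f (h + x) - f x - df h| <= e * `|h|) ->
  is_diff x f df.
Proof.
move=> cdf H.
have E : f \o shift x = cst (f x) + df +o_ 0 id.
  apply/eqaddoP => e e0; apply: filterS (H e e0) => h /=.
  by rewrite opprD addrA.
have D := diff_unique cdf E; apply: DiffDef => //.
by apply/diff_locallyP; rewrite D.
Qed.

Lemma is_diff_near_eq f g (x : V) : (\near x, f x = g x) ->
  differentiable f x -> is_diff x g ('d f x).
Proof.
move=> fg df; apply: (@is_diff_littleo g ('d f x)); first exact: diff_continuous.
move=> e /(differentiable_littleo df); rewrite -(nbhs_singleton fg).
have : \forall h \near (0 : V), f (h + x) = g (h + x).
  by move: fg; rewrite (near_shift 0 x) subr0.
by apply: filterS2 => h ->.
Qed.

Lemma differentiable_near_eq f g (x : V) : (\near x, f x = g x) ->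
  differentiable f x -> differentiable g x.
Proof. by move=> fg /(is_diff_near_eq fg) []. Qed.

End Congruence.

(** * Scalar maps of class C^k *)

Section ScalarCk.
Context {R : realType}.

(* Scalar-valued maps of class C^k are closed under products and inverses, hence
   under determinants and entries of inverse matrices. *)
Fixpoint Ck_scalar (n k : nat) (U : set 'rV[R]_n) (f : 'rV[R]_n -> R) : Prop :=
  match k with
  | 0%N => forall v, U v -> {for v, continuous f}
  | k'.+1 => (forall v, U v -> differentiable f v) /\
             (forall w, Ck_scalar k' U (fun v => 'D_w f v))
  end.

(** Openness of [U] makes the two maps agree near each of its points, so their derivatives agree on
    [U] too and the induction goes through. *)
Lemma Ck_scalar_ext n k (U : set 'rV[R]_n) f g : open U ->
  (forall v, U v -> f v = g v) -> Ck_scalar k U f -> Ck_scalar k U g.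
Proof.
move=> oU; elim: k f g => [|k IH] f g fg /=.
  move=> fc v Uv; apply: (@continuous_near_eq _ _ f); last exact: fc.
  by apply: filterS (open_nbhs_nbhs (conj oU Uv)).
have nfg v : U v -> \near v, f v = g v.
  by move=> Uv; apply: filterS (open_nbhs_nbhs (conj oU Uv)).
move=> [df Df]; split=> [v Uv|w].
  by apply: (differentiable_near_eq (nfg _ Uv)); exact: df.
apply: IH (Df w) => v Uv; apply: near_eq_derive; exact: nfg.
Qed.

Lemma Ck_scalarW n k (U : set 'rV[R]_n) f : Ck_scalar k.+1 U f -> Ck_scalar k U f.
Proof.
elim: k f => [|k IH] f [df Df] /=.
  by move=> v /df; exact: differentiable_continuous.
by split=> // w; apply: IH.
Qed.

Lemma Ck_scalar_sub n k (U V : set 'rV[R]_n) f : V `<=` U -> Ck_scalar k U f ->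
  Ck_scalar k V f.
Proof.
move=> VU; elim: k f => [|k IH] f /=; first by move=> cf v /VU /cf.
by move=> [df Df]; split=> [v /VU /df //|w]; exact: IH.
Qed.

Lemma Ck_scalar_cst n k (U : set 'rV[R]_n) a : open U -> Ck_scalar k U (cst a).
Proof.
move=> oU; elim: k a => [|k IH] a /=; first by move=> v _; exact: cst_continuous.
split=> [v _|w]; first exact: differentiable_cst.
apply: Ck_scalar_ext (IH 0) => // v _ /=.
by rewrite derive_cst.
Qed.

Lemma Ck_scalarD n k (U : set 'rV[R]_n) f g : open U -> Ck_scalar k U f ->
  Ck_scalar k U g ->
  Ck_scalar k U (fun v => f v + g v).
Proof.
move=> oU; elim: k f g => [|k IH] f g /=.
  by move=> cf cg v Uv; apply: continuousD; [exact: cf|exact: cg].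
move=> [df Df] [dg Dg]; split=> [v Uv|w].
  by apply: differentiableD; [exact: df|exact: dg].
apply: Ck_scalar_ext (IH _ _ (Df w) (Dg w)) => // v Uv /=.
by rewrite deriveD//; apply: diff_derivable; [exact: df|exact: dg].
Qed.

Lemma Ck_scalarM n k (U : set 'rV[R]_n) f g : open U -> Ck_scalar k U f ->
  Ck_scalar k U g ->
  Ck_scalar k U (fun v => f v * g v).
Proof.
move=> oU; elim: k f g => [|k IH] f g.
  by move=> cf cg v Uv; apply: continuousM; [exact: cf|exact: cg].
(* The Leibniz rule leaves one factor of each term undifferentiated, so [f] and [g] are also kept at
   order [k]. *)
move=> /[dup] /Ck_scalarW cf [df Df] /[dup] /Ck_scalarW cg [dg Dg]; split=> [v Uv|w].
  by apply: differentiableM; [exact: df|exact: dg].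
apply: Ck_scalar_ext (Ck_scalarD oU (IH _ _ cf (Dg w)) (IH _ _ cg (Df w)))
  => // v Uv /=.
by rewrite deriveM//; apply: diff_derivable; [exact: df|exact: dg].
Qed.

Lemma Ck_scalar_sum n k (U : set 'rV[R]_n) I (r : seq I) (P : pred I) F : open U ->
  (forall i, P i -> Ck_scalar k U (F i)) ->
  Ck_scalar k U (fun v => \sum_(i <- r | P i) F i v).
Proof.
move=> oU cF; elim: r => [|i r IH].
  by apply: (@Ck_scalar_ext _ _ _ (cst 0)) => // [v _|]; [rewrite big_nil|exact:
    Ck_scalar_cst].
case Pi : (P i).
  apply: Ck_scalar_ext (Ck_scalarD oU (cF _ Pi) IH) => // v _.
  by rewrite big_cons Pi.
by apply: Ck_scalar_ext IH => // v _; rewrite big_cons Pi.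
Qed.

Lemma Ck_scalar_prod n k (U : set 'rV[R]_n) I (r : seq I) (P : pred I) F : open U ->
  (forall i, P i -> Ck_scalar k U (F i)) ->
  Ck_scalar k U (fun v => \prod_(i <- r | P i) F i v).
Proof.
move=> oU cF; elim: r => [|i r IH].
  by apply: (@Ck_scalar_ext _ _ _ (cst 1)) => // [v _|]; [rewrite big_nil|exact:
    Ck_scalar_cst].
case Pi : (P i).
  apply: Ck_scalar_ext (Ck_scalarM oU (cF _ Pi) IH) => // v _.
  by rewrite big_cons Pi.
by apply: Ck_scalar_ext IH => // v _; rewrite big_cons Pi.
Qed.

(** The derivative of 1/f is - Df / f^2, a product of maps of class C^k as soon as 1/f itself is of
    class C^k. *)
Lemma Ck_scalarV n k (U : set 'rV[R]_n) f : open U -> (forall v, U v -> f v != 0) ->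
  Ck_scalar k U f -> Ck_scalar k U (fun v => (f v)^-1).
Proof.
move=> oU f0; elim: k => [|k IH].
  by move=> cf v Uv; apply: continuousV; [exact: f0|exact: cf].
move=> /[dup] /Ck_scalarW cf [df Df]; split=> [v Uv|w].
  by apply: differentiableV; [exact: df|exact: f0].
have H := Ck_scalarM oU (Ck_scalar_cst k (-1) oU) (Ck_scalarM oU (Df w)
  (Ck_scalarM oU (IH cf) (IH cf))).
apply: Ck_scalar_ext H => // v Uv /=.
rewrite (@deriveV _ _ f v w (f0 v Uv)) /=; last by apply: diff_derivable; exact: df.
by rewrite mulN1r scaleNr expr2 invfM; congr (- _); exact: mulrC.
Qed.

Lemma Ck_scalar_coord n k (U : set 'rV[R]_n) (i : 'I_n) : open U ->
  Ck_scalar k U (fun v => v 0 i).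
Proof.
move=> oU; case: k => [|k] /=; first by move=> v _; exact: coord_continuous.
split=> [v _|w]; first exact: differentiable_coord.
apply: (@Ck_scalar_ext _ _ _ (cst (w 0 i))) => // [v _|]; last exact: Ck_scalar_cst.
rewrite deriveE; last exact: differentiable_coord.
(* The coordinate as a bundled linear map, so that it is its own differential. *)
have @L : {linear 'rV[R]_n -> R}.
  by exists (fun v : 'rV[R]_n => v 0 i); do 2![eexists]; do ?[constructor];
     rewrite ?mxE// => ? *; rewrite ?mxE//; move=> ?; rewrite !mxE.
by rewrite /cst (_ : (fun _ => _) = L) // diff_lin //; exact: coord_continuous.
Qed.

End ScalarCk.

(** * Vector-valued maps, Jacobians and germs of smooth maps *)

Section VectorCk.
Context {R : realType}.

Lemma differentiable_rowP (V : normedModType R) m (f : V -> 'rV[R]_m) x :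
  differentiable f x <-> forall i, differentiable (fun v => f v 0 i) x.
Proof.
split=> [df i|df].
  exact: (differentiable_comp df (differentiable_coord (f x) 0 i)).
have -> : f = \sum_(i < m) (fun v => f v 0 i *: delta_mx 0 i).
  by apply/funext => v; rewrite fct_sumE [LHS]row_sum_delta.
exact: (differentiable_sum (fun i => differentiableZl (delta_mx 0 i) (df i))).
Qed.

Lemma derive_row (V : normedModType R) m (f : V -> 'rV[R]_m) x w i :
  differentiable f x -> ('D_w f x) 0 i = 'D_w (fun v => f v 0 i) x.
Proof. by move=> df; rewrite derive_mx ?mxE//; exact: diff_derivable. Qed.

Lemma continuous_row (T : topologicalType) m (f : T -> 'rV[R]_m) (v : T) :
  (forall i, {for v, continuous (fun x => f x 0 i)}) -> {for v, continuous f}.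
Proof.
move=> cf; apply/cvgrPdist_le => /= e e0.
have : \forall x \near v, forall i, `|f v 0 i - f x 0 i| <= e.
  apply: filter_forall => i.
  exact: ((@cvgrPdist_le _ _ _ _ _ (fun v => f v 0 i) _).1 (cf i)).
apply: filterS => x fx.
rewrite /Num.Def.normr/= mx_normrE (bigmax_le _ (ltW e0))//= => -[i j] _.
by rewrite !mxE/= !ord1; exact: fx.
Qed.

(** Passes from the vector-valued notion to the scalar one, where sums, products and quotients are
    available. *)
Lemma Ck_onP n m k (U : set 'rV[R]_n) (f : 'rV[R]_n -> 'rV[R]_m) : open U ->
  Ck_on k U f <-> forall i, Ck_scalar k U (fun v => f v 0 i).
Proof.
move=> oU; elim: k f => [|k IH] f /=.
  split=> [cf i v Uv|cf v Uv].
    exact: (continuous_comp (cf v Uv) (@coord_continuous _ _ _ 0 i (f v))).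
  by apply: continuous_row => i; exact: cf.
split=> [[df Df] i|H].
  split=> [v Uv|w]; first exact: (differentiable_rowP _ _).1 (df v Uv) i.
  apply: (Ck_scalar_ext oU _ ((IH _).1 (Df w) i)) => v Uv.
  by rewrite derive_row//; exact: df.
have df v : U v -> differentiable f v.
  by move=> Uv; apply/differentiable_rowP => i; exact: (H i).1 v Uv.
split=> // w; apply/IH => i.
by apply: (Ck_scalar_ext oU _ ((H i).2 w)) => v Uv; rewrite derive_row//; exact: df.
Qed.

Lemma Ck_on_sub n m k (U V : set 'rV[R]_n) (f : 'rV[R]_n -> 'rV[R]_m) :
  V `<=` U -> Ck_on k U f -> Ck_on k V f.
Proof.
move=> VU; elim: k f => [|k IH] f /=; first by move=> cf v /VU /cf.
by move=> [df Df]; split=> [v /VU /df //|w]; apply: IH; exact: Df.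
Qed.

Lemma diff_jacobian n m (f : 'rV[R]_n -> 'rV[R]_m) x w :
  'd f x w = w *m 'J f x.
Proof. by rewrite /jacobian mul_rV_lin1. Qed.

Lemma jacobianE n m (f : 'rV[R]_n -> 'rV[R]_m) x i j : differentiable f x ->
  'J f x i j = 'D_(delta_mx 0 i) (fun v => f v 0 j) x.
Proof.
move=> df; rewrite -(derive_row _ _ df) (deriveE _ df) diff_jacobian.
by rewrite -rowE [RHS]mxE.
Qed.

Lemma is_diff_jacobian n m (f : 'rV[R]_n -> 'rV[R]_m) x (A : 'M[R]_(n, m)) :
  is_diff x f (mulmxr A) -> 'J f x = A.
Proof.
move=> [_ df]; apply/row_matrixP => i.
by rewrite !rowE -diff_jacobian df.
Qed.

Lemma jacobian_comp n m p (f : 'rV[R]_n -> 'rV[R]_m) (g : 'rV[R]_m -> 'rV[R]_p) x :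
  differentiable f x -> differentiable g (f x) ->
  'J (g \o f) x = 'J f x *m 'J g (f x).
Proof.
move=> df dg; apply/row_matrixP => i.
by rewrite !rowE -diff_jacobian diff_comp //= !diff_jacobian mulmxA.
Qed.

Lemma mulmxr_continuous n m (A : 'M[R]_(n, m)) :
  continuous (fun v : 'rV[R]_n => v *m A).
Proof.
move=> v; have H : Ck_on 0 setT (fun v : 'rV[R]_n => v *m A).
  apply/Ck_onP => [|i]; first exact: openT.
  apply: (@Ck_scalar_ext _ _ _ _ (fun v => \sum_j v 0 j * A j i)).
  - exact: openT.
  - by move=> u _; rewrite mxE.
  apply: Ck_scalar_sum => [|j _]; first exact: openT.
  by apply: Ck_scalarM; [exact: openT|apply: Ck_scalar_coord; exact: openT|
     apply: Ck_scalar_cst; exact: openT].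
exact: (H v I).
Qed.

Lemma is_diff_mulmxr n m (A : 'M[R]_(n, m)) x :
  is_diff x (fun v : 'rV[R]_n => v *m A) (mulmxr A).
Proof.
pose L : {linear 'rV[R]_n -> 'rV[R]_m} := mulmxr A.
have cL : continuous L by exact: mulmxr_continuous.
rewrite -[fun _ => _]/(L : _ -> _) -[mulmxr A]/(L : _ -> _).
by apply: DiffDef; [exact: linear_differentiable|rewrite diff_lin].
Qed.

Lemma jacobian_near_eq n m (f g : 'rV[R]_n -> 'rV[R]_m) x :
  (\near x, f x = g x) -> differentiable f x -> 'J f x = 'J g x.
Proof.
move=> fg df; apply/esym/is_diff_jacobian.
have -> : (mulmxr ('J f x) : 'rV[R]_n -> 'rV[R]_m) = 'd f x :> (_ -> _).
  by apply/funext => w; rewrite (diff_jacobian f x w).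
exact: is_diff_near_eq.
Qed.

(** By the chain rule the derivative along [w] is the sum over i of D_w f_i times the composite of
    the i-th partial derivative of [g] with [f]; these composites are covered by the induction
    hypothesis. *)
Lemma Ck_scalar_comp n m k (U : set 'rV[R]_n) (W : set 'rV[R]_m)
    (f : 'rV[R]_n -> 'rV[R]_m) (g : 'rV[R]_m -> R) :
  open U -> open W -> (forall v, U v -> W (f v)) ->
  (forall i, Ck_scalar k U (fun v => f v 0 i)) -> Ck_scalar k W g ->
    Ck_scalar k U (g \o f).
Proof.
move=> oU oW UW; elim: k g => [|k IH] g.
  move=> /(Ck_onP 0 f oU) cf cg v Uv.
  exact: (continuous_comp (cf _ Uv) (cg _ (UW _ Uv))).
move=> cf [dg Dg].
have df v : U v -> differentiable f v.
  by move=> Uv; apply/differentiable_rowP => i; have [+ _] := cf i; apply.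
have ckf i := Ck_scalarW (cf i).
split=> [v Uv|w].
  exact: (differentiable_comp (df _ Uv) (dg _ (UW _ Uv))).
apply: (@Ck_scalar_ext _ _ _ _ (fun v => \sum_i 'D_w (fun v => f v 0 i) v *
   (('D_(delta_mx 0 i) g) \o f) v)) => // [v Uv|].
  have dgv := dg _ (UW _ Uv).
  have dfv := df _ Uv.
  rewrite [RHS]deriveE; last exact: differentiable_comp.
  have E : 'd f v w = \sum_i 'D_w (fun v => f v 0 i) v *: 'e_i.
    rewrite [LHS]row_sum_delta; apply: eq_bigr => i _.
    by rewrite -(derive_row _ _ dfv) (deriveE _ dfv).
  rewrite diff_comp //= E linear_sum; apply: eq_bigr => i _.
  by rewrite linearZ /= (deriveE _ dgv).
apply: Ck_scalar_sum => // i _; apply: Ck_scalarM => //; first exact: (cf i).2.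
by apply: IH => //; exact: Dg.
Qed.

(** Smoothness on some neighbourhood: composites and changes of chart then need no bookkeeping of
    open domains. *)
Definition smooth_germ n m (f : 'rV[R]_n -> 'rV[R]_m) (x : 'rV[R]_n) :=
  exists U, [/\ open U, U x & smooth_on U f].

(** Locality is proved order by order: local regularity of order [k.+1] passes to the directional
    derivatives with order [k]. *)
Lemma smooth_onP n m (U : set 'rV[R]_n) (f : 'rV[R]_n -> 'rV[R]_m) : open U ->
  smooth_on U f <-> (forall x, U x -> smooth_germ f x).
Proof.
move=> oU; split=> [sf x Ux|sf]; first by exists U.
have {}sf k : forall x, U x -> exists V, [/\ open V, V x & Ck_on k V f].
  by move=> x /sf[V [oV Vx sV]]; exists V; split=> //; exact: sV.
move=> k; move: (sf k) => {sf}; elim: k f => [|k IH] f sf.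
  by move=> v /sf[V [oV Vx cV]]; exact: (cV v Vx).
split=> [v /sf[V [oV Vx [dV _]]]|w]; first exact: dV.
by apply: IH => v /sf[V [oV Vx [_ DV]]]; exists V; split=> //; exact: DV.
Qed.

Lemma smooth_germ_differentiable n m (f : 'rV[R]_n -> 'rV[R]_m) x :
  smooth_germ f x -> differentiable f x.
Proof. by move=> [U [oU Ux sU]]; exact: (sU 1%N).1 x Ux. Qed.

Lemma smooth_germ_continuous n m (f : 'rV[R]_n -> 'rV[R]_m) x :
  smooth_germ f x -> {for x, continuous f}.
Proof. by move=> [U [oU Ux sU]]; exact: (sU 0%N x Ux). Qed.

Lemma smooth_germ_near n m (f : 'rV[R]_n -> 'rV[R]_m) x :
  smooth_germ f x -> \forall x \near x, smooth_germ f x.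
Proof.
move=> [U [oU Ux sU]]; apply: filterS (open_nbhs_nbhs (conj oU Ux)) => y Uy.
by exists U.
Qed.

Lemma smooth_germ_comp n m p (f : 'rV[R]_n -> 'rV[R]_m) (g : 'rV[R]_m -> 'rV[R]_p) x :
  smooth_germ f x -> smooth_germ g (f x) -> smooth_germ (g \o f) x.
Proof.
move=> [U [oU Ux sU]] [W [oW Wx sW]].
have oUW : open (U `&` f @^-1` W).
  rewrite openE => v [Uv Wv]; apply: filterI; first exact: open_nbhs_nbhs.
  by apply: (sU 0%N v Uv); exact: open_nbhs_nbhs.
exists (U `&` f @^-1` W); split=> // k; apply/Ck_onP => // i.
apply: (@Ck_scalar_comp _ _ k _ W f (fun v => g v 0 i)) => //.
- by move=> v [].
- by move=> j; apply: Ck_scalar_sub (((Ck_onP k f oU).1 (sU k)) j) => v [].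
- exact: (Ck_onP k g oW).1 (sW k) i.
Qed.

Lemma smooth_germ_near_eq n m (f g : 'rV[R]_n -> 'rV[R]_m) x :
  (\near x, f x = g x) -> smooth_germ f x -> smooth_germ g x.
Proof.
rewrite -nbhs_nearE nbhsE => -[V [oV Vx] fg] [U [oU Ux sU]].
have oI := openI oU oV.
exists (U `&` V); split=> // k; apply/Ck_onP => // i.
apply: (@Ck_scalar_ext _ _ _ _ (fun v => f v 0 i)) => //.
  by move=> v [Uv Vv]; rewrite fg.
by apply: Ck_scalar_sub (((Ck_onP k f oU).1 (sU k)) i) => v [].
Qed.

Lemma smooth_germ_rowP n m (f : 'rV[R]_n -> 'rV[R]_m) x :
  (exists U, [/\ open U, U x & forall k i, Ck_scalar k U (fun v => f v 0 i)]) ->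
  smooth_germ f x.
Proof. by move=> [U [oU Ux H]]; exists U; split=> // k; exact/Ck_onP. Qed.

Lemma smooth_germ_mulmxr n m (A : 'M[R]_(n, m)) x : smooth_germ (fun v :
  'rV_n => v *m A) x.
Proof.
apply: smooth_germ_rowP; exists setT; split=> // [|k i]; first exact: openT.
have oT := @openT 'rV[R]_n.
apply: (@Ck_scalar_ext _ _ _ _ (fun v => \sum_j v 0 j * A j i)) => //.
  by move=> u _; rewrite mxE.
apply: Ck_scalar_sum => // j _.
by apply: Ck_scalarM => //; [exact: Ck_scalar_coord|exact: Ck_scalar_cst].
Qed.

Lemma smooth_germ_id n x : smooth_germ (@id 'rV[R]_n) x.
Proof.
by apply: smooth_germ_near_eq (smooth_germ_mulmxr 1%:M x); apply: near_all => v;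
  rewrite mulmx1.
Qed.

Lemma smooth_germ_cst n m (a : 'rV[R]_m) (x : 'rV[R]_n) : smooth_germ (fun=> a) x.
Proof.
apply: smooth_germ_rowP; exists setT; split=> // [|k i]; first exact: openT.
by apply: (@Ck_scalar_cst _ _ k _ (a 0 i)); exact: openT.
Qed.

Lemma smooth_germ_row_mx n m1 m2 (f : 'rV[R]_n -> 'rV[R]_m1) (g : 'rV[R]_n ->
  'rV[R]_m2) x :
  smooth_germ f x -> smooth_germ g x -> smooth_germ (fun v => row_mx (f v) (g v)) x.
Proof.
move=> [U [oU Ux sU]] [V [oV Vx sV]]; have oI := openI oU oV.
apply: smooth_germ_rowP; exists (U `&` V); split=> // k i; case: (split_ordP i) => j ->.
  apply: (@Ck_scalar_ext _ _ _ _ (fun v => f v 0 j)) => //.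
    by move=> u _; rewrite row_mxEl.
  by apply: Ck_scalar_sub (((Ck_onP k f oU).1 (sU k)) j) => v [].
apply: (@Ck_scalar_ext _ _ _ _ (fun v => g v 0 j)) => //.
  by move=> u _; rewrite row_mxEr.
by apply: Ck_scalar_sub (((Ck_onP k g oV).1 (sV k)) j) => v [].
Qed.

Lemma smooth_germ_lsubmx n m x : smooth_germ (fun v : 'rV[R]_(n + m) => lsubmx v) x.
Proof.
apply: smooth_germ_near_eq (smooth_germ_mulmxr (col_mx 1%:M 0) x); apply: near_all => v.
by rewrite -[X in X *m _]hsubmxK mul_row_col mulmx1 mulmx0 addr0.
Qed.

Lemma smooth_germ_rsubmx n m x : smooth_germ (fun v : 'rV[R]_(n + m) => rsubmx v) x.
Proof.
apply: smooth_germ_near_eq (smooth_germ_mulmxr (col_mx 0 1%:M) x); apply: near_all => v.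
by rewrite -[X in X *m _]hsubmxK mul_row_col mulmx1 mulmx0 add0r.
Qed.

End VectorCk.

(** * The inverse function theorem *)

Lemma near_imply (T : topologicalType) (x : T) (P Q : T -> Prop) :
  (forall y, P y -> Q y) -> (\forall y \near x, P y) -> \forall y \near x, Q y.
Proof. by move=> PQ; apply: filterS. Qed.

Lemma near_and (T : topologicalType) (x : T) (P Q : T -> Prop) :
  (\forall y \near x, P y) -> (\forall y \near x, Q y) ->
  \forall y \near x, P y /\ Q y.
Proof. by move=> nP nQ; apply: filterI. Qed.

Lemma near_forall (T : topologicalType) (x : T) (I : finType)
    (P : I -> T -> Prop) :
  (forall i, \forall y \near x, P i y) -> \forall y \near x, forall i, P i y.
Proof. exact: filter_forall. Qed.

Lemma continuous_near (S T : topologicalType) (g : S -> T) x (P : T -> Prop) :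
  {for x, continuous g} -> (\forall y \near g x, P y) ->
  \forall z \near x, P (g z).
Proof. by move=> cg Pg; exact: (cg P Pg). Qed.

Lemma near_open (T : topologicalType) (U : set T) x :
  open U -> U x -> \forall y \near x, U y.
Proof. by move=> oU Ux; exact: open_nbhs_nbhs. Qed.

Lemma open_near (T : topologicalType) (U : set T) :
  (forall x, U x -> \forall y \near x, U y) -> open U.
Proof. by rewrite openE. Qed.

(** Completeness of spaces of matrices, in particular of row vectors, to which Banach's fixed point
    theorem is applied. *)
HB.instance Definition _ (R : realType) (m n : nat) :=
  Uniform_isComplete.Build 'M[R]_(m, n) (@cauchy_cvg _).

Section InverseFunction.
Context {R : realType}.

Lemma ball_segment n (c x y : 'rV[R]_n) e t : ball c e x -> ball c e y ->
  0 <= t <= 1 -> ball c e (t *: (y - x) + x).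
Proof.
rewrite -!ball_normE /ball_ /= => cx cy /andP[t0 t1].
have -> : c - (t *: (y - x) + x) = (1 - t) *: (c - x) + t *: (c - y).
  by apply/rowP => i; rewrite !mxE; ring.
apply: le_lt_trans (ler_normD _ _) _; rewrite !normrZ !ger0_norm ?subr_ge0//.
(* Strictness comes from the term with the factor [1 - t], so [t = 1] is treated apart. *)
have [t1'|] := ltP t 1; last first.
  move=> t1'; have -> : t = 1 by apply/le_anti/andP.
  by rewrite subrr mul0r add0r mul1r.
have : (1 - t) * `|c - x| < (1 - t) * e by rewrite ltr_pM2l// subr_gt0.
have : t * `|c - y| <= t * e by rewrite ler_wpM2l// ltW.
lra.
Qed.

Lemma is_derive_line n (f : 'rV[R]_n -> R) x w (t : R) :
  differentiable f (t *: w + x) ->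
  is_derive t 1 (fun t => f (t *: w + x)) ('D_w f (t *: w + x)).
Proof.
move=> df; have dw := @diff_derivable _ _ _ _ _ w df.
have E : (fun h : R => h^-1 *: (((fun t => f (t *: w + x)) \o shift t) (h *: 1) -
    f (t *: w + x))) =
  (fun h : R => h^-1 *: ((f \o shift (t *: w + x)) (h *: w) - f (t *: w + x))).
  apply/funext => h /=; congr (_ *: (f _ - _)).
  by rewrite [h *: 1](mulr1 h) scalerDl addrA.
by split; rewrite /derivable /derive E.
Qed.

Lemma mean_value n (f : 'rV[R]_n -> R) c e x y : ball c e x -> ball c e y ->
  (forall v, ball c e v -> differentiable f v) ->
  exists2 z, ball c e z & f y - f x = 'D_(y - x) f z.
Proof.
move=> cx cy df.
have itvP (t : R) : t \in `[0, 1] -> 0 <= t <= 1 by rewrite in_itv.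
have Hd (t : R) : 0 <= t <= 1 -> is_derive t 1 (fun t => f (t *: (y - x) + x))
    ('D_(y - x) f (t *: (y - x) + x)).
  by move=> t01; apply: is_derive_line; apply: df; exact: ball_segment.
have H1 (t : R) : t \in `]0, 1[ -> is_derive t 1
    (fun t => f (t *: (y - x) + x)) ('D_(y - x) f (t *: (y - x) + x)).
  by rewrite in_itv => /andP[t0 t1]; apply: Hd; rewrite !ltW.
have H2 : {within `[0, 1], continuous (fun t : R => f (t *: (y - x) + x))}.
  by apply: derivable_within_continuous => t /itvP /Hd [].
have [t /itvP t01] := MVT_segment ler01 H1 H2.
rewrite scale1r scale0r add0r subrK subr0 mulr1 => ->.
by exists (t *: (y - x) + x) => //; exact: ball_segment.
Qed.

Lemma Ck_scalar_jacobian n m k (U : set 'rV[R]_n) (f : 'rV[R]_n -> 'rV[R]_m) i j :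
  open U -> Ck_on k.+1 U f -> Ck_scalar k U (fun v => 'J f v i j).
Proof.
move=> oU /[dup] [[df _]] /(Ck_onP _ _ oU)/(_ j) [_ /(_ 'e_i)].
apply: (Ck_scalar_ext oU) => v Uv; rewrite jacobianE //; exact: df.
Qed.

Lemma Ck_scalar_det n k (U : set 'rV[R]_n) m (A : 'rV[R]_n -> 'M[R]_m) : open U ->
  (forall i j, Ck_scalar k U (fun v => A v i j)) -> Ck_scalar k U (fun v => \det (A v)).
Proof.
move=> oU cA; rewrite /determinant; apply: Ck_scalar_sum => // s _.
apply: Ck_scalarM => //; first exact: Ck_scalar_cst.
by apply: Ck_scalar_prod.
Qed.

(** Cramer's rule: an entry of the inverse is a cofactor divided by the determinant. *)
Lemma Ck_scalar_invmx n k (U : set 'rV[R]_n) m (A : 'rV[R]_n -> 'M[R]_m) i j :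
  open U -> (forall v, U v -> A v \in unitmx) ->
  (forall i j, Ck_scalar k U (fun v => A v i j)) ->
  Ck_scalar k U (fun v => invmx (A v) i j).
Proof.
move=> oU uA cA.
apply: (@Ck_scalar_ext _ _ _ _
  (fun v => (\det (A v))^-1 * cofactor (A v) j i)) => // [v Uv|].
  by rewrite /invmx (uA _ Uv) !mxE.
apply: Ck_scalarM => //.
  apply: Ck_scalarV => //; first by move=> v /uA; rewrite unitmxE unitfE.
  exact: Ck_scalar_det.
rewrite /cofactor; apply: Ck_scalarM => //; first exact: Ck_scalar_cst.
apply: Ck_scalar_det => // i' j'.
apply: Ck_scalar_ext (cA (lift j i') (lift i j')) => // v _.
by rewrite !mxE.
Qed.

Lemma jacobian_continuous n m (f : 'rV[R]_n -> 'rV[R]_m) x i j : smooth_germ f x ->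
  {for x, continuous (fun v => 'J f v i j)}.
Proof. by move=> [U [oU Ux /(_ 1%N)/(Ck_scalar_jacobian i j oU)]]; apply. Qed.

Lemma unit_jacobian_near n (f : 'rV[R]_n -> 'rV[R]_n) x : smooth_germ f x ->
  'J f x \in unitmx -> \forall v \near x, 'J f v \in unitmx.
Proof.
move=> [U [oU Ux sU]] ux.
have cd : {for x, continuous (fun v => \det ('J f v))}.
  apply: (@Ck_scalar_det n 0 U _ (fun v => 'J f v) oU _ x Ux) => i j.
  by apply: Ck_scalar_jacobian => //; exact: sU.
have d0 : \det ('J f x) != 0 by rewrite -unitfE -unitmxE.
have := cd _ (open_nbhs_nbhs (conj (@open_neq R 0) d0)).
by apply: near_imply => v; rewrite /= unitmxE unitfE.
Qed.

(* The sup norm on row vectors lets the mean value theorem be applied to each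
   coordinate of [x - f x]. *)
Lemma near_identity_contraction n (f : 'rV[R]_n -> 'rV[R]_n) x0 :
  smooth_germ f x0 -> 'J f x0 = 1%:M ->
  exists2 e, 0 < e & (forall v, ball x0 e v -> smooth_germ f v /\ 'J f v \in unitmx) /\
    forall x y, ball x0 e x -> ball x0 e y ->
      `|(x - f x) - (y - f y)| <= 2^-1 * `|x - y|.
Proof.
move=> sf J1.
(* Each coordinate is a sum of [n] terms bounded by [|x - y|] times an entry of [1 - 'J f z]; with
   this bound on the entries the sum is at most [|x - y| / 2]. Taking [n.+1] keeps the bound
   positive when [n] is 0. *)
have c0 : 0 < (2 * n.+1%:R : R)^-1 by rewrite invr_gt0 mulr_gt0// ltr0n.
have : \forall v \near x0, (smooth_germ f v /\ 'J f v \in unitmx) /\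
    forall i j, `|'J f v i j - (1%:M : 'M[R]_n) i j| < (2 * n.+1%:R)^-1.
  apply: near_and.
    apply: near_and; first exact: smooth_germ_near.
    by apply: unit_jacobian_near => //; rewrite J1 unitmx1.
  apply: near_forall => i; apply: near_forall => j.
  have := @jacobian_continuous _ _ f x0 i j sf; rewrite /prop_for /continuous_at J1.
  move=> /cvgrPdist_lt /(_ _ c0).
  by apply: near_imply => v; rewrite distrC.
rewrite -nbhs_nearE => /nbhs_ballP[e e0 eH]; exists e => //.
split=> [v /eH[]//|x y xe ye].
rewrite [leLHS]/Num.Def.normr/= mx_normrE; apply/bigmax_leP; split.
  by rewrite mulr_ge0.
move=> [i j] _ /=; rewrite [i]ord1 {i}.
pose h (v : 'rV[R]_n) := v 0 j - f v 0 j.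
have dh v : ball x0 e v -> differentiable h v.
  move=> /eH[[/smooth_germ_differentiable/differentiable_rowP dfv _] _].
  by apply: differentiableB; [exact: differentiable_coord|exact: dfv].
have [z ze zE] := @mean_value n h x0 e y x ye xe dh.
rewrite !mxE -/(h x) -/(h y) zE.
have [[/smooth_germ_differentiable dfz _] Hz] := eH _ ze.
have dcz : differentiable (fun v : 'rV[R]_n => v 0 j) z by exact: differentiable_coord.
have dfjz := (differentiable_rowP _ _).1 dfz j.
have -> : 'D_(x - y) h z = ((x - y) *m (1%:M - 'J f z)) 0 j.
  rewrite /h deriveB; [|exact: diff_derivable..].
  rewrite -(derive_row _ _ dfz) (deriveE _ dfz) diff_jacobian.
  rewrite mulmxBr mulmx1 [RHS]mxE; congr (_ + _); last by rewrite [RHS]mxE.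
  by rewrite -(@derive_row _ _ _ id z)// derive_id.
rewrite mxE; apply: le_trans (ler_norm_sum _ _ _) _.
apply: (@le_trans _ _ (\sum_(k < n) `|x - y| * (2 * n.+1%:R)^-1)).
  apply: ler_sum => k _; rewrite normrM ler_pM//.
    rewrite [leRHS]/Num.Def.normr/= mx_normrE.
    exact: (le_bigmax _ (fun ij : 'I_1 * 'I_n => `|(x - y) ij.1 ij.2|) (0, k)).
  rewrite mxE [X in _ + X]mxE ltW// distrC; exact: Hz.
rewrite sumr_const card_ord -[leLHS]mulr_natr -mulrA [leRHS]mulrC ler_wpM2l//.
rewrite invfM -mulrA ler_piMr ?invr_ge0//.
by rewrite mulrC ler_pdivrMr ?ltr0n// mul1r ler_nat.
Qed.

Lemma mulmxr_bound n m (A : 'M[R]_(n, m)) :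
  exists2 K : R, 0 < K & forall v : 'rV[R]_n, `|v *m A| <= K * `|v|.
Proof.
have [|K [K0 KH]] := @linear_lipschitz R 'rV[R]_n 'rV[R]_m (mulmxr A).
  exact: mulmxr_continuous.
by exists K.
Qed.

(** Put k = g (h + y) - g y and let J be the Jacobian of [f]. Differentiability of [f] gives h = k J
    + o(k), so k - h J^-1 = - (h - k J) J^-1 is o(k), and the Lipschitz bound turns o(k) into
    o(h). *)
Lemma is_diff_inverse n (f g : 'rV[R]_n -> 'rV[R]_n) x y C : 0 < C ->
  differentiable f x -> 'J f x \in unitmx -> g y = x ->
  (\forall z \near y, f (g z) = z) ->
  (\forall z \near y, `|g z - g y| <= C * `|z - y|) ->
  is_diff y g (mulmxr (invmx ('J f x))).
Proof.
move=> C0 df uJ gy fg lip.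
have [K K0 KB] := mulmxr_bound (invmx ('J f x)).
(* The tolerance [e / (K * C)] below compensates the norm [K] of the inverse Jacobian and the
   Lipschitz constant [C]. *)
apply: is_diff_littleo; first exact: mulmxr_continuous.
move=> e e0; have d0 : 0 < e / (K * C) by rewrite divr_gt0// mulr_gt0.
have := differentiable_littleo df d0; rewrite -nbhs_nearE.
move=> /nbhs_ballP[r r0 rH].
have fg0 : \forall h \near (0 : 'rV[R]_n), f (g (h + y)) = h + y.
  by move: fg; rewrite (near_shift 0 y) subr0.
have lip0 : \forall h \near (0 : 'rV[R]_n), `|g (h + y) - g y| <= C * `|h|.
  move: lip; rewrite (near_shift 0 y) subr0; apply: near_imply => h /=.
  by rewrite addrK.
have rC0 : 0 < r / C by rewrite divr_gt0.
have small : \forall h \near (0 : 'rV[R]_n), `|h| < r / C.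
  rewrite -nbhs_nearE; apply/nbhs_ballP; exists (r / C) => // h.
  by rewrite -ball_normE /ball_/= sub0r normrN.
apply: near_imply (near_and small (near_and fg0 lip0)) => h [hs [fgh liph]].
pose k := g (h + y) - g y.
have kr : ball (0 : 'rV[R]_n) r k.
  rewrite -ball_normE /ball_/= sub0r normrN; apply: le_lt_trans liph _.
  by rewrite mulrC -ltr_pdivlMr.
have := rH _ kr; rewrite /k -[in X in f X]gy subrK fgh -{1}gy.
rewrite (nbhs_singleton fg) addrK -/k diff_jacobian => Hk.
have -> : g (h + y) - g y - h *m invmx ('J f x) =
    - ((h - k *m 'J f x) *m invmx ('J f x)).
  by rewrite mulmxBl mulmxK// opprB.
rewrite normrN; apply: le_trans (KB _) _.
apply: (@le_trans _ _ (K * (e / (K * C) * (C * `|h|)))).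
  rewrite ler_wpM2l ?(ltW K0)//; apply: le_trans Hk _.
  by rewrite ler_wpM2l // ltW.
rewrite le_eqVlt; apply/orP; left; apply/eqP.
by field; rewrite !gt_eqF.
Qed.

(** Bootstrap: the Jacobian of [g] is the inverse of that of [f] taken at [g y], hence is as regular
    as [g] itself, and [g] gains one order at each step. *)
Lemma smooth_inverse n (f g : 'rV[R]_n -> 'rV[R]_n) (V W : set 'rV[R]_n) C :
  0 < C -> open V -> open W -> (forall v, W v -> smooth_germ f v /\
    'J f v \in unitmx) ->
  (forall y, V y -> W (g y) /\ f (g y) = y) ->
  (forall y z, V y -> V z -> `|g z - g y| <= C * `|z - y|) ->
  smooth_on V g.
Proof.
move=> C0 oV oW fW gV lip.
have dg y : V y -> is_diff y g (mulmxr (invmx ('J f (g y)))).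
  move=> Vy; have [Wgy fgy] := gV _ Vy; have [sf uJ] := fW _ Wgy.
  apply: (is_diff_inverse C0) => //; first exact: smooth_germ_differentiable.
  - by apply: near_imply (open_nbhs_nbhs (conj oV Vy)) => z /gV[].
  - by apply: near_imply (open_nbhs_nbhs (conj oV Vy)) => z Vz; exact: lip.
have sfW : smooth_on W f by apply/smooth_onP => // v /fW[].
elim=> [y Vy|k IH].
  by apply: differentiable_continuous; have [] := dg _ Vy.
split=> [y Vy|w]; first by have [] := dg _ Vy.
apply/Ck_onP => // i.
apply: (@Ck_scalar_ext _ _ _ _
   (fun v => \sum_j w 0 j * invmx ('J f (g v)) j i)) => // [v Vv|].
  have [dgv E] := dg _ Vv.
  by rewrite (deriveE _ dgv) E /= mxE.
apply: Ck_scalar_sum => // j _; apply: Ck_scalarM => //; first exact: Ck_scalar_cst.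
apply: (@Ck_scalar_invmx _ k V _ (fun v => 'J f (g v))) => // [v /gV[/fW[]]//|a b].
apply: (@Ck_scalar_comp _ _ _ k V W g (fun v => 'J f v a b)) => //.
- by move=> v /gV[].
- exact/Ck_onP.
- exact: Ck_scalar_jacobian.
Qed.

(* The preimage of y is the fixed point of the contraction [x |-> y + (x - f x)]. *)
Lemma inverse_function_near_identity n (f : 'rV[R]_n -> 'rV[R]_n) x0 :
  smooth_germ f x0 -> 'J f x0 = 1%:M ->
  exists (g : 'rV[R]_n -> 'rV[R]_n) (U V : set 'rV[R]_n),
    [/\ open U /\ U x0, open V,
       forall x, U x -> [/\ V (f x), g (f x) = x, smooth_germ f x & 'J f x \in unitmx] &
       forall y, V y -> [/\ U (g y), f (g y) = y & smooth_germ g y]].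
Proof.
move=> sf J1; have [e e0 [eS eC]] := near_identity_contraction sf J1.
(* As [x - f x] contracts by 1/2, [f] shrinks distances by at most a factor 2: this gives
   injectivity and the Lipschitz constant of the inverse. *)
have expand x y : ball x0 e x -> ball x0 e y -> `|x - y| <= 2 * `|f x - f y|.
  move=> xe ye; have := eC _ _ xe ye.
  have : `|x - y| <= `|(x - f x) - (y - f y)| + `|f x - f y|.
    by apply: le_trans (ler_normD _ _); rewrite le_eqVlt; apply/orP; left;
       apply/eqP; congr (`| _ |); apply/rowP => i; rewrite !mxE; ring.
  lra.
(* For [y] in this ball the contraction preserves the closed ball of radius [e / 2]: it moves [x0]
   by less than e/4, and contributes at most half of e/2 besides. *)
pose V : set 'rV[R]_n := ball (f x0) (e / 4).
pose U := ball x0 e `&` f @^-1` V.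
have e40 : 0 < e / 4 by rewrite divr_gt0.
have oB : open (ball x0 e) by exact: ball_open.
have oV : open V by exact: ball_open.
have oU : open U.
  rewrite openE => v [ve Vv]; apply: filterI; first exact: open_nbhs_nbhs.
  have [/smooth_germ_continuous cf _] := eS _ ve.
  by apply: cf; exact: open_nbhs_nbhs.
have surj y : V y -> exists x, ball x0 e x /\ f x = y.
  move=> Vy; pose D : set 'rV[R]_n := closed_ball_ Num.Def.normr x0 (e / 2).
  have De : D `<=` ball x0 e.
    move=> x; rewrite /D -ball_normE /closed_ball_ /ball_ /= => /le_lt_trans; apply.
    by rewrite ltr_pdivrMr// ltr_pMr// ltr1n.
  pose T x := y + (x - f x).
  have fT : set_fun D D T.
    move=> x Dx; have := eC _ _ (ballxx x0 e0) (De _ Dx).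
    move: Vy Dx; rewrite /V /D -ball_normE /closed_ball_ /ball_ /=.
    have -> : x0 - T x = (f x0 - y) + ((x0 - f x0) - (x - f x)).
      by apply/rowP => i; rewrite !mxE; ring.
    have := ler_normD (f x0 - y) ((x0 - f x0) - (x - f x)).
    lra.
  have cT : is_contraction (mkfun_fun fT).
    exists (2^-1)%:nng; split; first by rewrite /= invf_lt1// ltr1n.
    move=> [a b] [/= Da Db].
    rewrite /mkfun /T [X in `|X|](_ : _ = (a - f a) - (b - f b)).
      by apply: eC; exact: De.
    by apply/rowP => i; rewrite !mxE; ring.
  have [||x Dx xE] := banach_fixed_point cT.
  - exact: closed_closed_ball_.
  - by exists x0; rewrite /D /closed_ball_ /= subrr normr0 divr_ge0// ltW.
  exists x; split; first exact: De.
  move: xE; rewrite /mkfun_fun /mkfun /= /T => /rowP xE.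
  by apply/rowP => i; move: (xE i); rewrite !mxE; lra.
(* A preimage in the ball, with [x0] as default when there is none. *)
pose g y := xget x0 [set x | ball x0 e x /\ f x = y].
have gP y : V y -> ball x0 e (g y) /\ f (g y) = y.
  by move=> /surj Hy; have := @xgetPex _ x0 [set x | ball x0 e x /\ f x = y] Hy.
have sg : smooth_on V g.
  apply: (@smooth_inverse _ f g V (ball x0 e) 2) => //.
  move=> y z /gP[ge fgy] /gP[ze fgz].
  by rewrite -[in leRHS]fgy -[in leRHS]fgz; exact: expand.
exists g, U, V; split=> //.
- by split => //; split; [exact: ballxx|exact: ballxx].
- move=> x [xe Vfx]; have [sfx ux] := eS _ xe; split=> //.
  have [ge fg] := gP _ Vfx.
  apply/eqP; rewrite -subr_eq0 -normr_le0.
  by have := expand _ _ ge xe; rewrite fg subrr normr0 mulr0.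
- move=> y Vy; have [ge fg] := gP _ Vy; split=> //; last exact:
  (smooth_onP _ oV).1 sg y Vy.
  by split=> //; rewrite /= /preimage /= fg.
Qed.

(** Composing [f] with the inverse of its Jacobian at [x0] reduces to an identity Jacobian. *)
Theorem inverse_function n (f : 'rV[R]_n -> 'rV[R]_n) x0 :
  smooth_germ f x0 -> 'J f x0 \in unitmx ->
  exists (g : 'rV[R]_n -> 'rV[R]_n) (U V : set 'rV[R]_n),
    [/\ open U /\ U x0, open V,
       forall x, U x -> [/\ V (f x), g (f x) = x, smooth_germ f x & 'J f x \in unitmx] &
       forall y, V y -> [/\ U (g y), f (g y) = y & smooth_germ g y]].
Proof.
move=> sf uJ; set B := invmx ('J f x0).
have JB v : smooth_germ f v -> 'J ((fun v => v *m B) \o f) v = 'J f v *m B.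
  move=> sfv; have [d _] := is_diff_mulmxr B (f v).
  rewrite jacobian_comp//; last exact: smooth_germ_differentiable.
  by rewrite (is_diff_jacobian (is_diff_mulmxr B (f v))).
have sfB : smooth_germ ((fun v => v *m B) \o f) x0.
  by apply: smooth_germ_comp => //; exact: smooth_germ_mulmxr.
have [||g [U [V [[oU Ux0] oV UP VP]]]] :=
    @inverse_function_near_identity n ((fun v => v *m B) \o f) x0.
- exact: sfB.
- by rewrite JB// mulmxV.
have BK v : (v *m B) *m 'J f x0 = v by rewrite mulmxKV.
have oVB : open ((fun v => v *m B) @^-1` V).
  by apply: open_comp => // v _; exact: mulmxr_continuous.
have fE : f = (fun v => v *m 'J f x0) \o ((fun v => v *m B) \o f).
  by apply/funext => v /=; rewrite BK.
have sU x : U x -> smooth_germ f x.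
  move=> /UP[_ _ sfx _]; rewrite fE; exact:
    (smooth_germ_comp sfx (smooth_germ_mulmxr _ _)).
exists (g \o (fun v => v *m B)), U, ((fun v => v *m B) @^-1` V); split.
- exact: conj oU Ux0.
- exact: oVB.
- move=> x Ux; have [Vx gx _ ux] := UP _ Ux; split.
  + exact: Vx.
  + exact: gx.
  + exact: sU.
  + by move: ux; rewrite (JB _ (sU _ Ux)) unitmx_mul => /andP[].
- move=> y Vy; have [Ug fg sg] := VP _ Vy; split.
  + exact: Ug.
  + by rewrite -[LHS]BK [_ *m B]fg BK.
  + exact: (smooth_germ_comp (smooth_germ_mulmxr _ _) sg).
Qed.

End InverseFunction.

(** * The constant rank theorem *)

Section ConstantRank.
Context {R : realType}.

Lemma jacobian_mulmxr n m p (f : 'rV[R]_n -> 'rV[R]_m) (B : 'M[R]_(m, p)) x :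
  differentiable f x -> 'J (fun x => f x *m B) x = 'J f x *m B.
Proof.
move=> df; have [d _] := is_diff_mulmxr B (f x).
have := jacobian_comp df d.
by rewrite (is_diff_jacobian (is_diff_mulmxr B (f x))).
Qed.

Lemma jacobian_id n (x : 'rV[R]_n) : 'J id x = 1%:M.
Proof.
apply: is_diff_jacobian.
have -> : (mulmxr 1%:M : 'rV[R]_n -> 'rV[R]_n) = id.
  by apply/funext => v /=; rewrite mulmx1.
exact: is_diff_id.
Qed.

Lemma jacobian_linear n m (B : 'M[R]_(n, m)) x :
  'J (fun x : 'rV_n => x *m B) x = B.
Proof. exact: is_diff_jacobian (is_diff_mulmxr B x). Qed.

Lemma jacobian_row_mx n m p (f : 'rV[R]_n -> 'rV[R]_m) (g : 'rV[R]_n -> 'rV[R]_p) x :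
  differentiable f x -> differentiable g x ->
  'J (fun x => row_mx (f x) (g x)) x = row_mx ('J f x) ('J g x).
Proof.
move=> df dg.
have dfg : differentiable (fun x => row_mx (f x) (g x)) x.
  apply/differentiable_rowP => i; case: (split_ordP i) => j ->.
    rewrite (_ : (fun _ => _) = (fun v => f v 0 j)).
      exact: (differentiable_rowP _ _).1 df j.
    by apply/funext => v; rewrite row_mxEl.
  rewrite (_ : (fun _ => _) = (fun v => g v 0 j)).
    exact: (differentiable_rowP _ _).1 dg j.
  by apply/funext => v; rewrite row_mxEr.
apply/matrixP => i j; rewrite (jacobianE _ _ dfg).
case: (split_ordP j) => k ->.
  have -> : (fun v => row_mx (f v) (g v) 0 (lshift p k)) = (fun v => f v 0 k).
    by apply/funext => v; rewrite row_mxEl.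
  rewrite [RHS]row_mxEl.
  exact: esym (jacobianE i k df).
have -> : (fun v => row_mx (f v) (g v) 0 (rshift m k)) = (fun v => g v 0 k).
  by apply/funext => v; rewrite row_mxEr.
rewrite [RHS]row_mxEr.
exact: esym (jacobianE i k dg).
Qed.

Lemma ball_row_mx n m (a a' : 'rV[R]_n) (b b' : 'rV[R]_m) e :
  ball (row_mx a b) e (row_mx a' b') <-> ball a e a' /\ ball b e b'.
Proof.
split=> [[e0 H]|[[e0 H1] [_ H2]]].
  split; split=> // i j.
    by have := H i (lshift m j); rewrite !row_mxEl.
  by have := H i (rshift n j); rewrite !row_mxEr.
split=> // i j; case: (split_ordP j) => k ->.
  by rewrite !row_mxEl; exact: H1.
by rewrite !row_mxEr; exact: H2.
Qed.

(* [(f x *m P, x *m Q)] are the straightening coordinates.  The first one is a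
   linear function of [f x], so that it only depends on the fibre of f. *)
Lemma constant_rank n m r (f : 'rV[R]_n -> 'rV[R]_m) x0
    (N : set 'rV[R]_n) : smooth_germ f x0 -> (\forall x \near x0, N x) ->
  (\forall x \near x0, \rank ('J f x) = r) ->
  exists q (P : 'M[R]_(m, r)) (Q : 'M[R]_(n, q))
    (w : 'rV[R]_(r + q) -> 'rV[R]_n) (e : R) (W : set 'rV[R]_n),
  [/\ [/\ n = (r + q)%N, 0 < e & \rank P = r],
      [/\ open W, W x0 & forall x, W x -> smooth_germ f x /\ N x],
      forall x, W x -> [/\ ball (f x0 *m P) e (f x *m P),
        ball (x0 *m Q) e (x *m Q) & w (row_mx (f x *m P) (x *m Q)) = x],
      forall a b, ball (f x0 *m P) e a -> ball (x0 *m Q) e b ->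
        [/\ W (w (row_mx a b)), f (w (row_mx a b)) *m P = a,
            w (row_mx a b) *m Q = b & smooth_germ w (row_mx a b)] &
      forall a b b', ball (f x0 *m P) e a -> ball (x0 *m Q) e b ->
        ball (x0 *m Q) e b' -> f (w (row_mx a b)) = f (w (row_mx a b'))].
Proof.
move=> sf xN rf; have r0 : \rank ('J f x0) = r := nbhs_singleton rf.
have [q nE] : exists q, n = (r + q)%N.
  by exists (n - r)%N; rewrite subnKC// -r0 rank_leq_row.
subst n; set A := 'J f x0 in r0.
have rm : (r <= m)%N by rewrite -r0 rank_leq_col.
(* [A] factors as [L *m pid_mx r *m row_ebase A]. With this [P], the product [A *m P] is the first
   [r] columns of the invertible matrix [L]; [Q] is made of the others, so that the Jacobian of
   [Phi] at [x0] is [L]. *)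
pose L := col_ebase A; pose P : 'M[R]_(m, r) := invmx (row_ebase A) *m pid_mx r.
have AP : A *m P = lsubmx L.
  rewrite /P -[X in X *m _]mulmx_ebase r0 -!mulmxA [row_ebase _ *m _]mulmxA.
  rewrite mulmxV ?row_ebase_unit// mul1mx mul_pid_mx minnn (minn_idPr rm).
  rewrite pid_mx_col -/L -[X in X *m _]hsubmxK mul_row_col.
  by rewrite mulmx1 mulmx0 addr0.
pose Q : 'M[R]_(r + q, q) := rsubmx L.
pose Phi x := row_mx (f x *m P) (x *m Q).
have sPhi x : smooth_germ f x -> smooth_germ Phi x.
  move=> sfx; apply: smooth_germ_row_mx; last exact: smooth_germ_mulmxr.
  exact: (smooth_germ_comp sfx (smooth_germ_mulmxr _ _)).
have JPhi x : smooth_germ f x -> 'J Phi x = row_mx ('J f x *m P) Q.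
  move=> sfx; rewrite /Phi jacobian_row_mx.
  - by rewrite jacobian_mulmxr ?jacobian_linear//; exact: smooth_germ_differentiable.
  - exact: smooth_germ_differentiable (smooth_germ_comp sfx (smooth_germ_mulmxr _ _)).
  - exact: smooth_germ_differentiable (smooth_germ_mulmxr _ _).
have uPhi : 'J Phi x0 \in unitmx.
  by rewrite JPhi// AP hsubmxK col_ebase_unit.
have [g [U [V [[oU Ux0] oV UP VP]]]] := inverse_function (sPhi _ sf) uPhi.
have [VPhi gPhi _ _] := UP _ Ux0.
have cg : {for Phi x0, continuous g}.
  by apply: smooth_germ_continuous; have [] := VP _ VPhi.
have good : \forall y \near Phi x0, V y /\
    ((smooth_germ f (g y) /\ N (g y)) /\ \rank ('J f (g y)) = r).
  apply: near_and; first exact: open_nbhs_nbhs.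
  have H : \forall x \near g (Phi x0),
      (smooth_germ f x /\ N x) /\ \rank ('J f x) = r.
    rewrite gPhi; apply: near_and; last exact: rf.
    by apply: near_and; [exact: smooth_germ_near|exact: xN].
  exact: (continuous_near cg H).
move: good; rewrite -nbhs_nearE => /nbhs_ballP[e e0 eV].
pose W := U `&` Phi @^-1` ball (Phi x0) e.
have oW : open W.
  rewrite openE => x [Ux ex]; apply: filterI; first exact: open_nbhs_nbhs.
  have [_ _ /smooth_germ_continuous cP _] := UP _ Ux.
  by apply: cP; apply: open_nbhs_nbhs; split => //; exact: ball_open.
have fW x : W x -> smooth_germ f x /\ N x.
  by move=> [Ux /eV[_ []]]; have [_ -> _ _] := UP _ Ux.
have gW y : ball (Phi x0) e y -> W (g y) /\ Phi (g y) = y.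
  by move=> ey; have [/VP[? E _] _] := eV _ ey; split=> //; split=> //;
    rewrite /preimage/= E.
(* The composite of [f] and [g] does not vary in the second coordinate. Its Jacobian B has rank [r],
   and B P is an identity block above a zero block. So the upper block of B has rank [r] and spans
   all rows; the lower block is X times the upper one, and multiplying by [P] gives X = 0. *)
have Jdown y : ball (Phi x0) e y -> dsubmx ('J (f \o g) y) = 0.
  move=> ey; have [/VP[Ugy Pgy sg] [[sfg _] rfg]] := eV _ ey.
  have JF : 'J (f \o g) y = 'J g y *m 'J f (g y).
    by apply: jacobian_comp; exact: smooth_germ_differentiable.
  have ug : 'J g y *m 'J Phi (g y) = 1%:M.
    rewrite -jacobian_comp; [|exact: smooth_germ_differentiable..|]; last first.
      exact: smooth_germ_differentiable (sPhi _ sfg).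
    rewrite -(jacobian_id y); apply: jacobian_near_eq.
      apply: near_imply (open_nbhs_nbhs (conj (ball_open _ _) ey)).
      by move=> z /gW[].
    by apply: smooth_germ_differentiable; apply: smooth_germ_comp => //; exact: sPhi.
  have rJF : \rank ('J (f \o g) y) = r.
    have fg1 : row_full ('J g y) by rewrite row_full_unit; exact: (mulmx1_unit ug).1.
    exact: etrans (congr1 _ JF) (etrans (eqmxMfull ('J f (g y)) fg1).1 rfg).
  have JFP : 'J (f \o g) y *m P = col_mx 1%:M 0.
    move: ug; rewrite JPhi// mul_mx_row mulmxA -JF scalar_mx_block block_mxEh.
    by move=> /eq_row_mx[].
  move: rJF JFP; move: ('J (f \o g) y) => B rB.
  rewrite -[X in X *m _]vsubmxK mul_col_mx => /eq_col_mx[J1 J2].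
  have rU : \rank (usubmx B) = r.
    apply/eqP; rewrite eqn_leq rank_leq_row /=.
    by rewrite -{1}(mxrank1 R r) -J1 mxrankM_maxl.
  have uB : (usubmx B <= B)%MS.
    by rewrite -{2}(vsubmxK B) -addsmxE addsmxSl.
  have dB : (dsubmx B <= B)%MS.
    by rewrite -{2}(vsubmxK B) -addsmxE addsmxSr.
  have Bu : (B <= usubmx B)%MS.
    by rewrite -(mxrank_leqif_sup uB) rU rB.
  have /submxP[X XE] := submx_trans dB Bu.
  by move: J2; rewrite XE -mulmxA J1 mulmx1 => ->; rewrite mul0mx.
have PhiE x : row_mx (f x *m P) (x *m Q) = Phi x by [].
have bPhi a b : ball (f x0 *m P) e a -> ball (x0 *m Q) e b ->
    ball (Phi x0) e (row_mx a b).
  by move=> ea eb; apply/ball_row_mx.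
have rP : \rank P = r.
  have uE : invmx (row_ebase A) \in unitmx by rewrite unitmx_inv row_ebase_unit.
  have fE : row_full (invmx (row_ebase A)) by rewrite row_full_unit; exact: uE.
  have E := (eqmxMfull (pid_mx r : 'M[R]_(m, r)) fE).1.
  exact: etrans E (rank_pid_mx _ rm (leqnn r)).
exists q, P, Q, g, e, W; split=> //.
- by split=> //; split => //; exact: ballxx.
- move=> x [Ux ex]; have [_ gx _ _] := UP _ Ux.
  by rewrite PhiE gx; have [] := (ball_row_mx _ _ _ _ _).1 ex.
- move=> a b ea eb; have eab := bPhi _ _ ea eb; have [Wg Pg] := gW _ eab.
  have [E1 E2] := eq_row_mx Pg.
  by split=> //; have [/VP[]] := eV _ eab.
(* Mean value theorem in a direction with zero first component: only the lower block of the Jacobian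
   is seen. *)
move=> a b b' ea eb eb'; apply/rowP => i.
have dF y : ball (Phi x0) e y -> differentiable (fun v => (f \o g) v 0 i) y.
  move=> ey; have [/VP[_ _ sg] [[sfg _] _]] := eV _ ey.
  exact: (differentiable_rowP _ _).1 (smooth_germ_differentiable (smooth_germ_comp sg sfg)) i.
have [z ez] := mean_value (bPhi _ _ ea eb') (bPhi _ _ ea eb) dF.
rewrite [X in X = _]/= => E; apply/eqP; rewrite -subr_eq0 E.
have [/VP[_ _ sg] [[sfg _] _]] := eV _ ez.
have dfg := smooth_germ_differentiable (smooth_germ_comp sg sfg).
rewrite -(derive_row _ _ dfg) (deriveE _ dfg) diff_jacobian.
rewrite opp_row_mx add_row_mx subrr -[X in _ *m X]vsubmxK mul_row_col Jdown//.
by rewrite mul0mx mulmx0 addr0 mxE.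
Qed.

(** At full rank the second straightening coordinate is void ([q = 0]), so the coordinates depend on
    [f x] only and inverting them gives a left inverse of [f]. *)
Lemma immersion_left_inverse n m (f : 'rV[R]_n -> 'rV[R]_m) x0 : smooth_germ f x0 ->
  (\forall x \near x0, \rank ('J f x) = n) ->
  exists l : 'rV[R]_m -> 'rV[R]_n,
    smooth_germ l (f x0) /\ \forall x \near x0, l (f x) = x.
Proof.
move=> sf rf.
have [q [P [Q [w [e [W [[nE e0 _] [oW Wx0 _] HW Hw _]]]]]]] :=
  constant_rank sf (near_all x0 (fun _ => I)) rf.
have q0 : q = 0%N by move: nE; rewrite -[LHS]addn0 => /addnI.
subst q; exists (fun y => w (row_mx (y *m P) (x0 *m Q))); split.
  have [b1 b2 _] := HW _ Wx0; have [_ _ _ sw] := Hw _ _ b1 b2.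
  have srow : smooth_germ (fun y => row_mx (y *m P) (x0 *m Q)) (f x0).
    by apply: smooth_germ_row_mx; [exact: smooth_germ_mulmxr|exact: smooth_germ_cst].
  exact: (smooth_germ_comp srow sw).
apply: near_imply (near_open oW Wx0) => x /HW[_ _ {2}<-].
by rewrite [x0 *m Q]thinmx0 [x *m Q]thinmx0.
Qed.

End ConstantRank.

(** * Smooth maps at a point *)

Section Charts.
Context {R : realType} {T : topologicalType}.
Implicit Type c : chart R T.

Lemma chart_near c x : is_chart c -> cdom c x -> \forall y \near x, cdom c y.
Proof. by move=> [oc _ _ _ _]; exact: near_open. Qed.

Lemma cinvK c x : is_chart c -> cdom c x -> cinv c (cfun c x) = x.
Proof. by move=> [_ _ + _ _]; exact. Qed.

Lemma cfun_continuous c x : is_chart c -> cdom c x -> {for x, continuous (cfun c)}.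
Proof. by move=> [_ _ _ H _] cx; exact: H. Qed.

Lemma cinv_continuous c x : is_chart c -> cdom c x ->
  {for cfun c x, continuous (cinv c)}.
Proof. by move=> [_ _ _ _ H] cx; apply: H; exists x. Qed.

Lemma cimage_near c x : is_chart c -> cdom c x ->
  \forall v \near cfun c x, cdom c (cinv c v) /\ cfun c (cinv c v) = v.
Proof.
move=> ic cx; have [_ oc _ _ _] := ic.
have : (cfun c @` cdom c) (cfun c x) by exists x.
move=> /(near_open oc); apply: near_imply => _ [y cy <-].
by rewrite cinvK.
Qed.

Lemma near_cinv c x (P : T -> Prop) : is_chart c -> cdom c x ->
  (\forall y \near x, P y) -> \forall v \near cfun c x, P (cinv c v).
Proof.
move=> ic cx Px; apply: (continuous_near (cinv_continuous ic cx)).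
by rewrite cinvK.
Qed.

End Charts.

Section SmoothAt.
Context {R : realType}.
Implicit Types X Y Z : chartedSpace R.

(** The condition on nearby points is not a consequence of the last one: [cfun d] is a total
    function, with arbitrary values off [cdom d]. *)
Definition chart_smooth (S T : topologicalType) (c : chart R S) (d : chart R T)
    (f : S -> T) x :=
  [/\ cdom c x, \forall y \near x, cdom d (f y) & smooth_germ (local_rep c d f)
    (cfun c x)].

Definition smooth_at X Y (f : X -> Y) (x : X) :=
  exists c d, [/\ atlas X c, atlas Y d & chart_smooth c d f x].

Lemma chart_smooth_continuous (S T : topologicalType) (c : chart R S) (d : chart R T)
    (f : S -> T) x : is_chart c -> is_chart d -> chart_smooth c d f x ->
  {for x, continuous f}.
Proof.
move=> ic id [cx dfx sf]; have dx := nbhs_singleton dfx.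
have C1 := continuous_comp (cfun_continuous ic cx) (smooth_germ_continuous sf).
have E : (local_rep c d f \o cfun c) x = cfun d (f x) by rewrite /local_rep /= cinvK.
have C2 : {for (local_rep c d f \o cfun c) x, continuous (cinv d)}.
  by rewrite E; exact: cinv_continuous.
apply: continuous_near_eq (continuous_comp C1 C2).
apply: near_imply (near_and (chart_near ic cx) dfx) => y [cy dy].
by rewrite /local_rep /= cinvK// cinvK.
Qed.

Lemma chart_smooth_comp (S T U : topologicalType) (c : chart R S) (d : chart R T)
    (e : chart R U) (f : S -> T) (g : T -> U) x :
  is_chart c -> is_chart d -> chart_smooth c d f x -> chart_smooth d e g (f x) ->
    chart_smooth c e (g \o f) x.
Proof.
move=> ic id sf [dfx egx sg]; have cf := chart_smooth_continuous ic id sf.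
have [cx dfn sfx] := sf; split=> //.
  exact: (continuous_near cf egx).
have E : local_rep c d f (cfun c x) = cfun d (f x) by rewrite /local_rep /= cinvK.
rewrite -E in sg.
apply: smooth_germ_near_eq (smooth_germ_comp sfx sg).
apply: near_imply (near_cinv ic cx dfn) => v dv.
by rewrite /local_rep /= cinvK.
Qed.

Lemma chart_smooth_near_eq (S T : topologicalType) (c : chart R S) (d : chart R T)
    (f g : S -> T) x : is_chart c ->
  (\near x, f x = g x) -> chart_smooth c d f x -> chart_smooth c d g x.
Proof.
move=> ic fg [cx dfx sf]; split=> //.
  by apply: near_imply (near_and fg dfx) => y [<-].
apply: smooth_germ_near_eq sf.
by apply: near_imply (near_cinv ic cx fg) => v E; rewrite /local_rep /= E.
Qed.

Lemma rep_dom_near (S T : topologicalType) (c : chart R S) (d : chart R T)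
    (f : S -> T) x : is_chart c -> cdom c x -> (\forall y \near x, cdom d (f y)) ->
  \forall v \near cfun c x, rep_dom c d f v.
Proof.
move=> ic cx dfx.
apply: near_imply (near_and (cimage_near ic cx) (near_cinv ic cx dfx)).
by move=> v [[cv <-] dv]; exists (cinv c v) => //; split => //; move: dv; rewrite cinvK.
Qed.

Lemma smooth_rep_chart_smooth (S T : topologicalType) (c : chart R S) (d : chart R T)
    (f : S -> T) x : is_chart c -> (\forall y \near x, cdom d (f y)) ->
  cdom c x -> smooth_rep c d f -> chart_smooth c d f x.
Proof.
move=> ic dfx cx sf; split=> //.
have := rep_dom_near ic cx dfx; rewrite -nbhs_nearE nbhsE => -[U [oU Ux] sU].
exists U; split=> // k; exact: Ck_on_sub sU (sf k).
Qed.

Lemma chart_smooth_smooth_rep (S T : topologicalType) (c : chart R S) (d : chart R T)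
    (f : S -> T) : is_chart c ->
  (forall x, cdom c x -> cdom d (f x) -> chart_smooth c d f x) -> smooth_rep c d f.
Proof.
move=> ic sf.
have od : open (rep_dom c d f).
  by apply: open_near => _ [x [cx dx] <-]; have [_ ? _] := sf _ cx dx; exact:
    rep_dom_near.
apply/(smooth_onP _ od) => _ [x [cx dx] <-].
by have [_ _] := sf _ cx dx.
Qed.

Lemma manifold_chart X c : is_manifold X -> atlas X c -> is_chart c.
Proof. by move=> [H _ _] ac; exact: H. Qed.

Lemma manifold_cover X (x : X) : is_manifold X ->
  exists c, [/\ atlas X c, is_chart c & cdom c x].
Proof.
move=> mX; have [_ /(_ x)[c ac cx] _] := mX.
by exists c; split=> //; exact: manifold_chart ac.
Qed.

Lemma manifold_transition X c d (x : X) : is_manifold X -> atlas X c ->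
  atlas X d -> cdom c x -> cdom d x -> chart_smooth c d id x.
Proof.
move=> mX ac ad cx dx; have [_ _ H] := mX.
apply: smooth_rep_chart_smooth => //; first exact: manifold_chart ac.
  by apply: chart_near => //; exact: manifold_chart ad.
exact: H.
Qed.

Lemma smooth_at_chart_smooth X Y (f : X -> Y) x c d : is_manifold X -> is_manifold Y ->
  smooth_at f x -> atlas X c -> atlas Y d -> cdom c x -> cdom d (f x) ->
  chart_smooth c d f x.
Proof.
move=> mX mY [c0 [d0 [ac0 ad0 sf]]] ac ad cx dx.
have ic := manifold_chart mX ac; have ic0 := manifold_chart mX ac0.
have id := manifold_chart mY ad; have id0 := manifold_chart mY ad0.
have [c0x d0x _] := sf.
have t1 := manifold_transition mX ac ac0 cx c0x.
have t2 := manifold_transition mY ad0 ad (nbhs_singleton d0x) dx.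
exact: (chart_smooth_comp ic id0 (chart_smooth_comp ic ic0 t1 sf) t2).
Qed.

Lemma smooth_at_chart X Y (f : X -> Y) x : is_manifold X -> is_manifold Y ->
  smooth_at f x -> exists c d, [/\ atlas X c /\ is_chart c,
    atlas Y d /\ is_chart d & chart_smooth c d f x].
Proof.
move=> mX mY [c [d [ac ad sf]]]; exists c, d; split; last exact: sf.
  by split; [exact: ac|exact: (manifold_chart mX ac)].
by split; [exact: ad|exact: (manifold_chart mY ad)].
Qed.

Lemma smooth_at_continuous X Y (f : X -> Y) x : is_manifold X -> is_manifold Y ->
  smooth_at f x -> {for x, continuous f}.
Proof.
move=> mX mY sf0; have [c [d [[_ ic] [_ id] sf]]] := smooth_at_chart mX mY sf0.
exact: (chart_smooth_continuous ic id sf).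
Qed.

Lemma smooth_at_comp X Y Z (f : X -> Y) (g : Y -> Z) x : is_manifold X ->
  is_manifold Y -> is_manifold Z -> smooth_at f x -> smooth_at g (f x) ->
  smooth_at (g \o f) x.
Proof.
move=> mX mY mZ /(smooth_at_chart mX mY)[c [d [[ac ic] [ad id] sf]]] sg.
have [e [ae ie ex]] := manifold_cover (g (f x)) mZ.
have [_ dx _] := sf.
have sg' := smooth_at_chart_smooth mY mZ sg ad ae (nbhs_singleton dx) ex.
by exists c, e; split => //; exact: chart_smooth_comp sg'.
Qed.

Lemma smooth_at_near_eq X Y (f g : X -> Y) x : is_manifold X ->
  (\near x, f x = g x) -> smooth_at f x -> smooth_at g x.
Proof.
move=> mX fg [c [d [ac ad sf]]]; exists c, d; split => //.
by apply: chart_smooth_near_eq sf => //; exact: manifold_chart ac.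
Qed.

Lemma smooth_at_near X Y (f : X -> Y) x : is_manifold X ->
  smooth_at f x -> \forall y \near x, smooth_at f y.
Proof.
move=> mX [c [d [ac ad [cx dx sf]]]].
have ic := manifold_chart mX ac.
have H : \forall y \near x, smooth_germ (local_rep c d f) (cfun c y).
  exact: continuous_near (cfun_continuous ic cx) (smooth_germ_near sf).
have dx' : \forall y \near x, \forall z \near y, cdom d (f z).
  by apply: near_join; exact: dx.
apply: near_imply (near_and (chart_near ic cx) (near_and H dx')) => y [cy [sy dy]].
by exists c, d.
Qed.

Lemma smooth_at_id X (x : X) : is_manifold X -> smooth_at (@id X) x.
Proof.
move=> mX; have [c [ac ic cx]] := manifold_cover x mX.
exists c, c; split=> //; exact: manifold_transition.
Qed.

Lemma smooth_at_cst X Y (x : X) (y : Y) : is_manifold X -> is_manifold Y ->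
  smooth_at (fun _ : X => y) x.
Proof.
move=> mX mY; have [c [ac ic cx]] := manifold_cover x mX.
have [d [ad id dy]] := manifold_cover y mY.
exists c, d; split=> //; split=> //; first exact: near_all.
exact: smooth_germ_cst.
Qed.

Lemma smoothP X Y (f : X -> Y) : is_manifold X -> is_manifold Y ->
  smooth f <-> forall x, smooth_at f x.
Proof.
move=> mX mY; split=> [[cf sf] x|sf].
  have [c [ac ic cx]] := manifold_cover x mX.
  have [d [ad id dx]] := manifold_cover (f x) mY.
  exists c, d; split => //; apply: smooth_rep_chart_smooth => //; last exact: sf.
  exact: (continuous_near (cf x) (chart_near id dx)).
split=> [x|c d ac ad]; first exact: smooth_at_continuous.
apply: chart_smooth_smooth_rep; first exact: manifold_chart ac.
by move=> x cx dx; exact: smooth_at_chart_smooth.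
Qed.

End SmoothAt.

(** * Euclidean spaces as manifolds with a single chart *)

Section Euclid.
Context {R : realType}.
Implicit Types X Y Z : chartedSpace R.

Definition idchart n : chart R 'rV[R]_n :=
  @Chart R 'rV[R]_n n setT id id.

Definition euclid n : chartedSpace R :=
  @ChartedSpace R 'rV[R]_n [set idchart n].

Lemma euclid_manifold n : is_manifold (euclid n).
Proof.
have oT : open (@setT 'rV[R]_n) := openT.
split=> [c ->|x|c d -> ->].
- split.
  + exact: oT.
  + by rewrite image_id.
  + by [].
  + by move=> x _; exact: cvg_id.
  + by move=> x _; exact: cvg_id.
- by exists (idchart n).
- have E : rep_dom (idchart n) (idchart n) id = setT.
    by rewrite /rep_dom /= image_id setTI.
  rewrite /smooth_rep E; apply/(smooth_onP _ oT) => x _.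
  exact: smooth_germ_id.
Qed.

Lemma smooth_at_germ n m (f : 'rV[R]_n -> 'rV[R]_m) x :
  @smooth_at R (euclid n) (euclid m) f x <-> smooth_germ f x.
Proof.
split=> [sf|sf].
  have [_ _] := smooth_at_chart_smooth (euclid_manifold n) (euclid_manifold m)
    sf erefl erefl I I.
  by [].
exists (idchart n), (idchart m); split=> //; split=> //; exact: near_all.
Qed.

Lemma smooth_at_cfun X c x : is_manifold X -> atlas X c -> cdom c x ->
  @smooth_at R X (euclid (cdim c)) (cfun c) x.
Proof.
move=> mX ac cx; have ic := manifold_chart mX ac.
exists c, (idchart _); split=> //; split=> //; first exact: near_all.
apply: smooth_germ_near_eq (smooth_germ_id _).
by apply: near_imply (cimage_near ic cx) => v [].
Qed.

Lemma smooth_at_cinv X c x : is_manifold X -> atlas X c -> cdom c x ->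
  @smooth_at R (euclid (cdim c)) X (cinv c) (cfun c x).
Proof.
move=> mX ac cx; have ic := manifold_chart mX ac.
exists (idchart _), c; split=> //; split=> //.
  by apply: near_imply (cimage_near ic cx) => v [].
apply: smooth_germ_near_eq (smooth_germ_id _).
by apply: near_imply (cimage_near ic cx) => v [].
Qed.

Lemma smooth_at_row_mx X n m (f : X -> 'rV[R]_n) (g : X -> 'rV[R]_m) x :
  is_manifold X -> @smooth_at R X (euclid n) f x ->
  @smooth_at R X (euclid m) g x ->
  @smooth_at R X (euclid (n + m)) (fun x => row_mx (f x) (g x)) x.
Proof.
move=> mX sf sg; have [c [ac ic cx]] := manifold_cover x mX.
have [_ _ sf'] := smooth_at_chart_smooth mX (euclid_manifold n) sf ac erefl cx I.
have [_ _ sg'] := smooth_at_chart_smooth mX (euclid_manifold m) sg ac erefl cx I.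
exists c, (idchart _); split=> //; split=> //; first exact: near_all.
exact: (smooth_germ_row_mx sf' sg').
Qed.

Lemma smooth_at_mulmx X n m (f : X -> 'rV[R]_n) (A : 'M[R]_(n, m)) x :
  is_manifold X -> @smooth_at R X (euclid n) f x ->
  @smooth_at R X (euclid m) (fun x => f x *m A) x.
Proof.
move=> mX sf.
have sA : @smooth_at R (euclid n) (euclid m) (fun v => v *m A) (f x).
  by apply/smooth_at_germ; exact: smooth_germ_mulmxr.
exact: (smooth_at_comp mX (euclid_manifold n) (euclid_manifold m) sf sA).
Qed.

End Euclid.

(** * Products and ranks *)

Section ProductManifold.
Context {R : realType}.
Implicit Types X Y Z : chartedSpace R.

Lemma continuous_row_mx (T : topologicalType) n m (f : T -> 'rV[R]_n)
    (g : T -> 'rV[R]_m) x : {for x, continuous f} -> {for x, continuous g} ->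
  {for x, continuous (fun x => row_mx (f x) (g x))}.
Proof.
move=> cf cg; apply: continuous_row => i; case: (split_ordP i) => j ->.
  have -> : (fun x => row_mx (f x) (g x) 0 (lshift m j)) = (fun x => f x 0 j).
    by apply/funext => y; rewrite row_mxEl.
  exact: (continuous_comp cf (@coord_continuous _ _ _ 0 j (f x))).
have -> : (fun x => row_mx (f x) (g x) 0 (rshift n j)) = (fun x => g x 0 j).
  by apply/funext => y; rewrite row_mxEr.
exact: (continuous_comp cg (@coord_continuous _ _ _ 0 j (g x))).
Qed.

Lemma continuous_pair (S T U : topologicalType) (f : S -> T) (g : S -> U) x :
  {for x, continuous f} -> {for x, continuous g} ->
  {for x, continuous (fun x => (f x, g x))}.
Proof. by move=> cf cg; apply: cvg_pair. Qed.

Lemma near_fst (S T : topologicalType) (x : S * T) (P : S -> Prop) :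
  (\forall y \near x.1, P y) -> \forall p \near x, P p.1.
Proof. by apply: continuous_near; exact: cvg_fst. Qed.

Lemma near_snd (S T : topologicalType) (x : S * T) (P : T -> Prop) :
  (\forall y \near x.2, P y) -> \forall p \near x, P p.2.
Proof. by apply: continuous_near; exact: cvg_snd. Qed.

Lemma prod_chart_is_chart (S T : topologicalType) (c : chart R S)
    (d : chart R T) : is_chart c -> is_chart d -> is_chart (prod_chart c d).
Proof.
move=> ic id; split.
- apply: open_near => p [cp dp].
  apply: near_and; first exact: near_fst (chart_near ic cp).
  exact: near_snd (chart_near id dp).
- apply: open_near => _ [[x y] [/= cx dy] <-].
  have Hc : \forall v \near row_mx (cfun c x) (cfun d y),
      (cfun c @` cdom c) (lsubmx v).
    apply: (continuous_near (smooth_germ_continuous (@smooth_germ_lsubmx _ _ _ _))).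
    by rewrite row_mxKl; have [_ oc _ _ _] := ic; apply: near_open => //; exists x.
  have Hd : \forall v \near row_mx (cfun c x) (cfun d y),
      (cfun d @` cdom d) (rsubmx v).
    apply: (continuous_near (smooth_germ_continuous (@smooth_germ_rsubmx _ _ _ _))).
    by rewrite row_mxKr; have [_ oc _ _ _] := id; apply: near_open => //; exists y.
  apply: near_imply (near_and Hc Hd) => v [[a ca aE] [b db bE]].
  by exists (a, b) => //=; rewrite aE bE hsubmxK.
- move=> [x y] [cx dy] /=; rewrite row_mxKl row_mxKr.
  by rewrite !cinvK.
- move=> [x y] [/= cx dy]; apply: continuous_row_mx.
    have c1 : {for (x, y), continuous (@fst S T)} by exact: cvg_fst.
    exact: (continuous_comp c1 (cfun_continuous ic cx)).
  have c2 : {for (x, y), continuous (@snd S T)} by exact: cvg_snd.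
  exact: (continuous_comp c2 (cfun_continuous id dy)).
- move=> _ [[x y] [/= cx dy] <-].
  have c1 := smooth_germ_continuous (@smooth_germ_lsubmx _ _ _ (row_mx (cfun c x)
    (cfun d y))).
  have c2 := smooth_germ_continuous (@smooth_germ_rsubmx _ _ _ (row_mx (cfun c x)
    (cfun d y))).
  apply: continuous_pair.
    apply: (continuous_comp c1); rewrite row_mxKl; exact: cinv_continuous.
  apply: (continuous_comp c2); rewrite row_mxKr; exact: cinv_continuous.
Qed.

Lemma chart_smooth_prod (S S' T T' : topologicalType) (c : chart R S) (c' : chart R S')
    (d : chart R T) (d' : chart R T') (f : S -> S') (g : T -> T') p :
  is_chart c -> is_chart d -> chart_smooth c c' f p.1 -> chart_smooth d d' g p.2 ->
  chart_smooth (prod_chart c d) (prod_chart c' d') (fun p => (f p.1, g p.2)) p.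
Proof.
case: p => x y /= ic id [cx fx sf] [dy gy sg]; split => //.
  have nf : \forall p \near (x, y), cdom c' (f p.1).
    exact: (@near_fst _ _ (x, y) (fun s => cdom c' (f s)) fx).
  have ng : \forall p \near (x, y), cdom d' (g p.2).
    exact: (@near_snd _ _ (x, y) (fun s => cdom d' (g s)) gy).
  exact: near_imply (near_and nf ng).
have sl := @smooth_germ_lsubmx _ _ _ (row_mx (cfun c x) (cfun d y)).
have sr := @smooth_germ_rsubmx _ _ _ (row_mx (cfun c x) (cfun d y)).
rewrite /prod_chart /=; apply: smooth_germ_row_mx.
  rewrite -{1}(row_mxKl (cfun c x) (cfun d y)) in sf.
  exact: (smooth_germ_comp sl sf).
rewrite -{1}(row_mxKr (cfun c x) (cfun d y)) in sg.
exact: (smooth_germ_comp sr sg).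
Qed.

Lemma prod_manifold X Y : is_manifold X -> is_manifold Y ->
  is_manifold (prod_space X Y).
Proof.
move=> mX mY; split.
- move=> _ [c [d [ac ad ->]]].
  by apply: prod_chart_is_chart; [exact: manifold_chart ac|exact: manifold_chart ad].
- move=> [x y]; have [c [ac ic cx]] := manifold_cover x mX.
  have [d [ad id dy]] := manifold_cover y mY.
  by exists (prod_chart c d) => //; exists c, d.
- move=> _ _ [c [d [ac ad ->]]] [c' [d' [ac' ad' ->]]].
  have ic := manifold_chart mX ac; have id := manifold_chart mY ad.
  apply: chart_smooth_smooth_rep; first exact: prod_chart_is_chart.
  move=> [x y] [/= cx dy] [/= cx' dy'].
  have := chart_smooth_prod (p := (x, y)) ic id (manifold_transition mX ac ac' cx cx')
    (manifold_transition mY ad ad' dy dy').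
  apply: chart_smooth_near_eq; first exact: prod_chart_is_chart.
  by apply: near_all => -[].
Qed.

Lemma smooth_at_fst X Y p : is_manifold X -> is_manifold Y ->
  @smooth_at R (prod_space X Y) X fst p.
Proof.
case: p => x y mX mY; have [c [ac ic cx]] := manifold_cover x mX.
have [d [ad id dy]] := manifold_cover y mY.
exists (prod_chart c d), c; split=> //; first by exists c, d.
split => //; first exact: (@near_fst _ _ (x, y) (cdom c) (chart_near ic cx)).
have sl := @smooth_germ_lsubmx _ _ _ (row_mx (cfun c x) (cfun d y)).
have [_ _ sf] := manifold_transition mX ac ac cx cx.
rewrite -{1}(row_mxKl (cfun c x) (cfun d y)) in sf.
exact: (smooth_germ_comp sl sf).
Qed.

Lemma smooth_at_snd X Y p : is_manifold X -> is_manifold Y ->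
  @smooth_at R (prod_space X Y) Y snd p.
Proof.
case: p => x y mX mY; have [c [ac ic cx]] := manifold_cover x mX.
have [d [ad id dy]] := manifold_cover y mY.
exists (prod_chart c d), d; split=> //; first by exists c, d.
split => //; first exact: (@near_snd _ _ (x, y) (cdom d) (chart_near id dy)).
have sl := @smooth_germ_rsubmx _ _ _ (row_mx (cfun c x) (cfun d y)).
have [_ _ sf] := manifold_transition mY ad ad dy dy.
rewrite -{1}(row_mxKr (cfun c x) (cfun d y)) in sf.
exact: (smooth_germ_comp sl sf).
Qed.

Lemma smooth_at_pair X Y Z (f : Z -> X) (g : Z -> Y) z : is_manifold X ->
  is_manifold Y -> is_manifold Z -> smooth_at f z -> smooth_at g z ->
  @smooth_at R Z (prod_space X Y) (fun z => (f z, g z)) z.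
Proof.
move=> mX mY mZ sf sg; have [c [ac ic cx]] := manifold_cover (f z) mX.
have [d [ad id dy]] := manifold_cover (g z) mY.
have [e [ae ie ez]] := manifold_cover z mZ.
have [_ fz sf'] := smooth_at_chart_smooth mZ mX sf ae ac ez cx.
have [_ gz sg'] := smooth_at_chart_smooth mZ mY sg ae ad ez dy.
exists e, (prod_chart c d); split=> //; first by exists c, d.
by split => //; [exact: near_and|exact: (smooth_germ_row_mx sf' sg')].
Qed.

End ProductManifold.

(** * Ranks of maps with a local section or a local retraction *)

Section Rank.
Context {R : realType}.
Implicit Types X Y Z : chartedSpace R.

Lemma jacobian_rep_comp (S T U : topologicalType) (c : chart R S) (d : chart R T)
    (e : chart R U) (f : S -> T) (g : T -> U) x : is_chart c -> is_chart d ->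
  chart_smooth c d f x -> chart_smooth d e g (f x) ->
  'J (local_rep c e (g \o f)) (cfun c x) =
  'J (local_rep c d f) (cfun c x) *m 'J (local_rep d e g) (cfun d (f x)).
Proof.
move=> ic id [cx dfx sf] [_ _ sg].
have E : local_rep c d f (cfun c x) = cfun d (f x) by rewrite /local_rep /= cinvK.
rewrite -{1}E in sg; rewrite -E.
rewrite -(jacobian_comp (smooth_germ_differentiable sf)
  (smooth_germ_differentiable sg)).
apply/esym; apply: jacobian_near_eq; last exact:
  smooth_germ_differentiable (smooth_germ_comp sf sg).
apply: near_imply (near_cinv ic cx dfx) => v dv.
by rewrite /local_rep /= cinvK.
Qed.

Lemma jacobian_rep_id (S : topologicalType) (c : chart R S) (f : S -> S) x :
  is_chart c -> cdom c x -> (\near x, f x = x) ->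
  'J (local_rep c c f) (cfun c x) = 1%:M.
Proof.
move=> ic cx fx; rewrite -(jacobian_id (cfun c x)); apply/esym.
apply: jacobian_near_eq; last exact: smooth_germ_differentiable (smooth_germ_id _).
apply: near_imply (near_and (cimage_near ic cx) (near_cinv ic cx fx)) => v [[_ E1] E2].
by rewrite /local_rep /= E2 E1.
Qed.

(** The chain rule for [f \o s] gives J(s) J(f) = 1, so the rank of J(f) is its number of
    columns. *)
Lemma section_rank X Y (f : X -> Y) (s : Y -> X) x c d : is_manifold X ->
  is_manifold Y -> smooth_at f x -> smooth_at s (f x) -> s (f x) = x ->
  (\forall y \near f x, f (s y) = y) -> atlas X c -> atlas Y d -> cdom c x ->
  cdom d (f x) -> rank_rep c d f x = cdim d.
Proof.
move=> mX mY sf ss sfx fs ac ad cx dx.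
have ic := manifold_chart mX ac; have id := manifold_chart mY ad.
rewrite -{1}sfx in cx.
have s1 := smooth_at_chart_smooth mY mX ss ad ac dx cx.
rewrite sfx in cx.
have s2 := smooth_at_chart_smooth mX mY sf ac ad cx dx.
rewrite -{1}sfx in s2.
have E := jacobian_rep_comp id ic s1 s2.
rewrite (jacobian_rep_id id dx fs) in E; rewrite sfx in E.
apply/eqP; rewrite eqn_leq rank_leq_col /=.
by rewrite -{1}(mxrank1 R (cdim d)) E; exact: mxrankM_maxr.
Qed.

Lemma retract_rank X Y (f : X -> Y) (l : Y -> X) x c d : is_manifold X ->
  is_manifold Y -> smooth_at f x -> smooth_at l (f x) ->
  (\forall y \near x, l (f y) = y) -> atlas X c -> atlas Y d -> cdom c x ->
  cdom d (f x) -> rank_rep c d f x = cdim c.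
Proof.
move=> mX mY sf sl lf ac ad cx dx.
have ic := manifold_chart mX ac; have id := manifold_chart mY ad.
have lfx : l (f x) = x := nbhs_singleton lf.
have s1 := smooth_at_chart_smooth mX mY sf ac ad cx dx.
have s2 : chart_smooth d c l (f x) by apply: smooth_at_chart_smooth; rewrite ?lfx.
have E := jacobian_rep_comp ic id s1 s2.
rewrite (jacobian_rep_id ic cx lf) in E.
apply/eqP; rewrite eqn_leq rank_leq_row /=.
by rewrite -{1}(mxrank1 R (cdim c)) E; exact: mxrankM_maxl.
Qed.

End Rank.

(** * Constant rank maps between manifolds *)

Section ManifoldConstantRank.
Context {R : realType}.
Implicit Types X Y Z : chartedSpace R.

(** The constant rank theorem in charts. The first coordinates are stated as a function [u] of the
    target point, because only [u \o f] descends to a quotient by subsets of fibres of [f]. *)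
Lemma manifold_constant_rank X Y (f : X -> Y) x0 c d r : is_manifold X ->
  is_manifold Y -> atlas X c -> atlas Y d -> cdom c x0 -> cdom d (f x0) ->
  (\forall x \near x0, smooth_at f x) ->
  (\forall x \near x0, rank_rep c d f x = r) ->
  exists q (P : 'M[R]_(cdim d, r)) (v : X -> 'rV[R]_q)
    (w : 'rV[R]_(r + q) -> X) (e : R) (W : set X),
  let u y := cfun d y *m P in
  [/\ [/\ cdim c = (r + q)%N, 0 < e & \rank P = r],
      [/\ open W, W x0 & forall x, W x -> [/\ cdom d (f x), smooth_at f x &
         @smooth_at R X (euclid q) v x]],
      forall x, W x -> [/\ ball (u (f x0)) e (u (f x)),
        ball (v x0) e (v x) & w (row_mx (u (f x)) (v x)) = x],
      forall a b, ball (u (f x0)) e a -> ball (v x0) e b ->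
        [/\ W (w (row_mx a b)), u (f (w (row_mx a b))) = a,
            v (w (row_mx a b)) = b &
            @smooth_at R (euclid (r + q)) X w (row_mx a b)] &
      forall a b b', ball (u (f x0)) e a -> ball (v x0) e b ->
        ball (v x0) e b' -> f (w (row_mx a b)) = f (w (row_mx a b'))].
Proof.
move=> mX mY ac ad cx dx sf rf.
have ic := manifold_chart mX ac; have id := manifold_chart mY ad.
have nd : \forall x \near x0, cdom d (f x).
  exact: (continuous_near (smooth_at_continuous mX mY (nbhs_singleton sf))
    (chart_near id dx)).
(* Confines the box to the points where the local representative has a meaning. *)
pose N v := (cdom c (cinv c v) /\ cfun c (cinv c v) = v) /\
  (smooth_at f (cinv c v) /\ cdom d (f (cinv c v))).
have nN : \forall v \near cfun c x0, N v.
  exact: near_and (cimage_near ic cx) (near_cinv ic cx (near_and sf nd)).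
have [_ _ sF] := smooth_at_chart_smooth mX mY (nbhs_singleton sf) ac ad cx dx.
have nr : \forall v \near cfun c x0, \rank ('J (local_rep c d f) v) = r.
  apply: near_imply (near_and (cimage_near ic cx) (near_cinv ic cx rf)).
  by move=> v [[_ E] H]; rewrite -[in 'J _ v]E.
have [q [P [Q [w [e [W [[nE e0 rP] [oW Wx0 WN] HW Hw Hf]]]]]]] :=
  constant_rank sF nN nr.
have E x : cdom c x -> local_rep c d f (cfun c x) = cfun d (f x).
  by move=> xc; rewrite /local_rep /= cinvK.
rewrite (E _ cx) in HW Hw Hf.
exists q, P, (fun x => cfun c x *m Q), (cinv c \o w), e,
  (cdom c `&` cfun c @^-1` W) => u.
split.
- by [].
- split.
  + apply: open_near => x [xc Wx]; apply: near_and (chart_near ic xc) _.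
    exact: continuous_near (cfun_continuous ic xc) (near_open oW Wx).
  + by [].
  + move=> x [xc /WN[_ [_]]]; rewrite cinvK// => -[sx dfx]; split=> //.
    by apply: smooth_at_mulmx => //; exact: smooth_at_cfun.
- move=> x [xc /HW[+ + E3]]; rewrite (E _ xc) in E3 *; move=> H1 H2; split=> //.
  by rewrite /= E3 cinvK.
- move=> a b ea eb; have [Wab fab vab sw] := Hw _ _ ea eb.
  have [_ [[cab cabE] [sab dab]]] := WN _ Wab.
  split.
  + by split=> //; rewrite /preimage /= cabE.
  + by rewrite /u /= -[RHS]fab /local_rep.
  + by rewrite /= cabE.
  + apply: (smooth_at_comp (euclid_manifold _) (euclid_manifold _) mX).
      by apply/smooth_at_germ; exact: sw.
    by rewrite -cabE; exact: smooth_at_cinv.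
move=> a b b' ea eb eb'.
have [Wab _ _ _] := Hw _ _ ea eb; have [Wab' _ _ _] := Hw _ _ ea eb'.
have [_ [_ [_ dab]]] := WN _ Wab; have [_ [_ [_ dab']]] := WN _ Wab'.
rewrite /= -(cinvK id dab) -[RHS](cinvK id dab').
by have := Hf _ _ _ ea eb eb'; rewrite /local_rep /= => ->.
Qed.

(** When the rank is the dimension of the target, [P] is invertible, and the first coordinates may
    be replaced by the point [f x] itself: near [x0], X is a product of Y and a Euclidean space,
    with [s] as inverse of [(f, v)]. *)
Lemma submersion_section X Y (f : X -> Y) x0 c d : is_manifold X ->
  is_manifold Y -> atlas X c -> atlas Y d -> cdom c x0 -> cdom d (f x0) ->
  (\forall x \near x0, smooth_at f x) ->
  (\forall x \near x0, rank_rep c d f x = cdim d) ->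
  exists q (v : X -> 'rV[R]_q) (s : Y -> 'rV[R]_q -> X),
  [/\ cdim c = (cdim d + q)%N,
      @smooth_at R X (euclid q) v x0,
      @smooth_at R (prod_space Y (euclid q)) X (fun p => s p.1 p.2) (f x0, v x0),
      \forall p \near ((f x0, v x0) : Y * 'rV[R]_q),
         f (s p.1 p.2) = p.1 /\ v (s p.1 p.2) = p.2 &
      \forall x \near x0, s (f x) (v x) = x].
Proof.
move=> mX mY ac ad cx dx sf rf.
have ic := manifold_chart mX ac; have id := manifold_chart mY ad.
have [q [P [v [w [e [W [[nE e0 rP] [oW Wx0 WN] HW Hw Hf]]]]]]] :=
  manifold_constant_rank mX mY ac ad cx dx sf rf.
have Pu : P \in unitmx by rewrite -row_free_unit /row_free rP.
have [_ _ sv] := WN _ Wx0.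
have [b1 b2 wE] := HW _ Wx0.
have [_ _ _ sw] := Hw _ _ b1 b2.
have mE := euclid_manifold.
exists q, v, (fun y b => w (row_mx (cfun d y *m P) b)); split.
- exact: nE.
- exact: sv.
- have mP := prod_manifold mY (mE R q).
  apply: (smooth_at_comp mP (mE _ _) mX _ sw).
  apply: smooth_at_row_mx => //; last exact: smooth_at_snd.
  apply: smooth_at_mulmx => //.
  apply: (smooth_at_comp mP mY (mE _ _) (smooth_at_fst _ mY (mE _ _))).
  exact: smooth_at_cfun.
- have n1 : \forall y \near f x0, cdom d y /\ ball (cfun d (f x0) *m P)
  e (cfun d y *m P).
    apply: near_and (chart_near id dx) _.
    have cu : {for f x0, continuous (fun y => cfun d y *m P)}.
      have cP : {for cfun d (f x0), continuous (fun v : 'rV[R]__ => v *m P)}.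
        exact: mulmxr_continuous.
      exact: (continuous_comp (cfun_continuous id dx) cP).
    have nb : \forall a \near cfun d (f x0) *m P, ball (cfun d (f x0) *m P) e a.
      exact: (nbhsx_ballx _ _ e0).
    exact: (@continuous_near _ _ (fun y => cfun d y *m P) (f x0) (ball _ e) cu nb).
  have n2 : \forall b \near v x0, ball (v x0) e b.
    exact: (nbhsx_ballx _ _ e0).
  have H1 : \forall p \near ((f x0, v x0) : Y * 'rV[R]_q),
    cdom d p.1 /\ ball (cfun d (f x0) *m P) e (cfun d p.1 *m P).
    exact: (@near_fst _ _ (f x0, v x0) (fun y => cdom d y /\ ball (cfun d (f x0)
      *m P) e (cfun d y *m P)) n1).
  have H2 : \forall p \near ((f x0, v x0) : Y * 'rV[R]_q), ball (v x0) e p.2.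
    exact: (@near_snd _ _ (f x0, v x0) (ball (v x0) e) n2).
  apply: near_imply (near_and H1 H2) => -[y b] /= [[dy ey] eb].
  have [Wab fab vab _] := Hw _ _ ey eb; split => //.
  have [dab _ _] := WN _ Wab.
  rewrite -[LHS](cinvK id dab) -[RHS](cinvK id dy); congr (cinv d _).
  by apply: (can_inj (mulmxK Pu)); exact: fab.
- by apply: near_imply (near_open oW Wx0) => x /HW[].
Qed.

End ManifoldConstantRank.

(** * Embedded submanifolds *)

Section SubSpace.
Context {R : realType}.
Implicit Types X Y Z : chartedSpace R.

Lemma set_val_continuous (T : topologicalType) (A : set T) (x : set_type A) :
  {for x, continuous (@set_val T A)}.
Proof. exact: initial_continuous. Qed.

Lemma open_set_val (T : topologicalType) (A : set T) (U : set (set_type A)) :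
  open U <-> exists2 V : set T, open V & set_val @^-1` V = U.
Proof. by []. Qed.

Lemma continuous_set_val (S T : topologicalType) (A : set T) (f : S -> set_type A) x :
  {for x, continuous (@set_val T A \o f)} -> {for x, continuous f}.
Proof.
move=> cf U; rewrite nbhsE => -[B [/open_set_val[V oV VB] Bfx] BU].
have Vfx : V (set_val (f x)) by move: Bfx; rewrite -VB.
have := continuous_near cf (near_open oV Vfx).
apply: near_imply => y Vy; apply: BU; rewrite -VB; exact: Vy.
Qed.

Lemma set_val_in (T : Type) (A : set T) (x : set_type A) : A (set_val x).
Proof. exact: set_mem (valP x). Qed.

(* [x0] is a junk value, taken outside of A. *)
Definition sub_of (T : Type) (A : set T) (x0 : set_type A) (y : T) : set_type A :=
  if pselect (A y) is left Ay then exist _ y (mem_set Ay) else x0.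

Lemma sub_ofK (T : Type) (A : set T) (x0 : set_type A) y :
  A y -> set_val (sub_of x0 y) = y.
Proof. by rewrite /sub_of; case: pselect. Qed.

Lemma set_val_inj (T : Type) (A : set T) : injective (@set_val T A).
Proof. exact: val_inj. Qed.

(* Any chart of a subspace immerses it, so it extends to a smooth map of the
   ambient coordinates: this makes two such charts compatible. *)
Lemma sub_chart_left_inverse X (A : set X) c d (x : set_type A) : is_manifold X ->
  atlas (sub_space A) c -> cdom c x -> atlas X d -> cdom d (set_val x) ->
  exists l : 'rV[R]_(cdim d) -> 'rV[R]_(cdim c), smooth_germ l (cfun d (set_val x)) /\
    \forall y \near x, l (cfun d (set_val y)) = cfun c y.
Proof.
move=> mX [ic Hc] cx ad dx; have id := manifold_chart mX ad.
have [sr rk] := Hc _ ad.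
have dn : \forall y \near x, cdom d (set_val y).
  exact: (continuous_near (@set_val_continuous _ _ x) (chart_near id dx)).
have [_ _ sF] := smooth_rep_chart_smooth ic dn cx sr.
have rF : \forall v \near cfun c x,
    \rank ('J (local_rep c d (@set_val X A)) v) = cdim c.
  apply: near_imply (near_and (cimage_near ic cx) (near_cinv ic cx dn)).
  by move=> v [[cv E] dv]; rewrite -[in 'J _ v]E; exact: rk.
have [l [sl lF]] := immersion_left_inverse sF rF.
have E : local_rep c d (@set_val X A) (cfun c x) = cfun d (set_val x).
  by rewrite /local_rep /= cinvK.
rewrite E in sl; exists l; split=> //.
have H := continuous_near (cfun_continuous ic cx) lF.
apply: near_imply (near_and (chart_near ic cx) H) => y [cy].
by rewrite /local_rep /= cinvK.
Qed.

Definition embedded X (A : set X) := forall x : set_type A,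
  exists2 c, atlas (sub_space A) c & cdom c x.

(** A transition map is the inclusion read in the first chart, followed by the smooth left inverse
    belonging to the second. *)
Lemma sub_manifold X (A : set X) : is_manifold X -> embedded A ->
  is_manifold (sub_space A).
Proof.
move=> mX eA; split=> [c []//|//|c c' ac ac'].
have ic := ac.1; have ic' := ac'.1.
apply: chart_smooth_smooth_rep => // x cx cx'; split => //; first exact: chart_near.
have [d [ad id dx]] := manifold_cover (set_val x) mX.
have dn : \forall y \near x, cdom d (set_val y).
  exact: (continuous_near (@set_val_continuous _ _ x) (chart_near id dx)).
have [_ _ sF] := smooth_rep_chart_smooth ic dn cx (ac.2 _ ad).1.
have [l [sl lF]] := sub_chart_left_inverse mX ac' cx' ad dx.
have E : local_rep c d (@set_val X A) (cfun c x) = cfun d (set_val x).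
  by rewrite /local_rep /= cinvK.
rewrite -E in sl.
by apply: smooth_germ_near_eq (smooth_germ_comp sF sl); exact: (near_cinv ic cx lF).
Qed.

Lemma smooth_at_set_val X (A : set X) (x : set_type A) : is_manifold X ->
  embedded A -> @smooth_at R (sub_space A) X set_val x.
Proof.
move=> mX eA; have [c ac cx] := eA x.
have [d [ad id dx]] := manifold_cover (set_val x) mX.
exists c, d; split=> //; apply: smooth_rep_chart_smooth => //; first exact: ac.1.
  exact: (continuous_near (@set_val_continuous _ _ x) (chart_near id dx)).
exact: (ac.2 _ ad).1.
Qed.

(** Universal property of an embedded submanifold: continuity comes from the subspace topology,
    smoothness from the left inverse of a chart. *)
Lemma smooth_at_into_sub X Z (A : set X) (f : Z -> set_type A) z :
  is_manifold X -> is_manifold Z -> embedded A ->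
  @smooth_at R Z X (@set_val X A \o f) z -> @smooth_at R Z (sub_space A) f z.
Proof.
move=> mX mZ eA sf; have [c ac cx] := eA (f z).
have [d [ad id dx]] := manifold_cover (set_val (f z)) mX.
have [e [ae ie ez]] := manifold_cover z mZ.
have cf : {for z, continuous f}.
  by apply: continuous_set_val; exact: (smooth_at_continuous mZ mX sf).
have [_ _ sF] := smooth_at_chart_smooth mZ mX sf ae ad ez dx.
exists e, c; split=> //; split=> //.
  exact: (continuous_near cf (chart_near ac.1 cx)).
have [l [sl lF]] := sub_chart_left_inverse mX ac cx ad dx.
have E : local_rep e d (@set_val X A \o f) (cfun e z) = cfun d (set_val (f z)).
  by rewrite /local_rep /= cinvK.
rewrite -E in sl.
apply: smooth_germ_near_eq (smooth_germ_comp sF sl).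
exact: (near_cinv ie ez (continuous_near cf lF)).
Qed.

(** Source of all submanifold charts below: a smooth local parametrization [be] of A with a left
    inverse [al] that is smooth on the ambient manifold. Through [al] the parametrization is an
    immersion, and its inverse on A is continuous. *)
Lemma retract_chart X (A : set X) k (al : X -> 'rV[R]_k) (be : 'rV[R]_k -> X)
    (x0 : set_type A) : is_manifold X ->
  @smooth_at R X (euclid k) al (set_val x0) ->
  @smooth_at R (euclid k) X be (al (set_val x0)) ->
  be (al (set_val x0)) = set_val x0 ->
  (\forall v \near al (set_val x0), al (be v) = v /\ A (be v)) ->
  (\forall x \near set_val x0, A x -> be (al x) = x) ->
  exists c, [/\ atlas (sub_space A) c, cdom c x0 & cdim c = k].
Proof.
move=> mX sal sbe be0 alK beK; have mE := @euclid_manifold R k.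
have : \forall v \near al (set_val x0),
    @smooth_at R (euclid k) X be v /\ (al (be v) = v /\ A (be v)).
  exact: near_and (@smooth_at_near R (euclid k) X be _ mE sbe) alK.
rewrite -nbhs_nearE nbhsE => -[V [oV V0] VP].
have : \forall x \near set_val x0, (V (al x) /\ @smooth_at R X (euclid k) al x) /\
    (A x -> be (al x) = x).
  have H := continuous_near (smooth_at_continuous mX mE sal) (near_open oV V0).
  exact: near_and (near_and H (smooth_at_near mX sal)) beK.
rewrite -nbhs_nearE nbhsE => -[N [oN N0] NP].
pose c : chart R (set_type A) := @Chart R (set_type A) k
  [set x | N (set_val x)] (al \o set_val) (sub_of x0 \o be).
have cK v : V v -> set_val (sub_of x0 (be v)) = be v.
  by move=> /VP[_ [_ Ab]]; exact: sub_ofK.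
have Vnear v : V v -> \forall v \near v, V v by exact: near_open.
(* [V] and [N] are open sets on which the germ hypotheses hold at every point; the chart has domain
   the trace of [N], and this is its image. *)
have imP v : (cfun c @` cdom c) v <-> V v /\ N (be v).
  split=> [[x Nx <-]|[Vv Nv]] /=.
    have [[Vx _] /(_ (set_val_in x)) E] := NP _ Nx.
    by rewrite E.
  exists (sub_of x0 (be v)); rewrite /= cK//.
  by have [_ []] := VP _ Vv.
have ic : is_chart c.
  split.
  - by apply/open_set_val; exists N.
  - apply: open_near => v /imP[Vv Nv].
    have [sv _] := VP _ Vv.
    have H := continuous_near (smooth_at_continuous mE mX sv) (near_open oN Nv).
    by apply: near_imply (near_and (Vnear _ Vv) H) => y yP; apply/imP.
  - move=> x Nx; apply: set_val_inj; have [[Vx _] /(_ (set_val_in x)) E] := NP _ Nx.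
    by rewrite /= cK.
  - move=> x Nx; have [[_ sx] _] := NP _ Nx.
    exact: (continuous_comp (@set_val_continuous _ _ x)
      (smooth_at_continuous mX mE sx)).
  - move=> v /imP[Vv Nv]; apply: continuous_set_val; have [sv _] := VP _ Vv.
    apply: continuous_near_eq (smooth_at_continuous mE mX sv).
    by apply: near_imply (Vnear _ Vv) => y Vy; rewrite /= cK.
exists c; split=> //; split=> // d ad.
have id := manifold_chart mX ad.
have loc x : cdom c x -> cdom d (set_val x) ->
    chart_smooth (idchart k) d be (cfun c x) /\ (\forall v \near cfun c x,
      local_rep (idchart k) d be v = local_rep c d (@set_val X A) v).
  move=> Nx dx; have [Vx _] : V (cfun c x) /\ N (be (cfun c x)) by apply/imP; exists x.
  have [sv _] := VP _ Vx.
  have bex : be (cfun c x) = set_val x.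
    by have [_ /(_ (set_val_in x))] := NP _ Nx.
  split; first by apply: (smooth_at_chart_smooth mE mX sv) => //; rewrite bex.
  by apply: near_imply (Vnear _ Vx) => v Vv; rewrite /local_rep /= cK.
split.
  apply: chart_smooth_smooth_rep => // x Nx dx; have [[_ _ sb] E] := loc _ Nx dx.
  split=> //; first exact: (continuous_near (@set_val_continuous _ _ x)
    (chart_near id dx)).
  exact: smooth_germ_near_eq E sb.
move=> x Nx dx; have [[_ _ sb] E] := loc _ Nx dx.
have [Vx _] : V (cfun c x) /\ N (be (cfun c x)) by apply/imP; exists x.
have bex : be (cfun c x) = set_val x.
  by have [_ /(_ (set_val_in x))] := NP _ Nx.
have [sv _] := VP _ Vx.
have [[_ sax] _] := NP _ Nx; rewrite -bex in sax.
have alKx : \forall v \near cfun c x, al (be v) = v.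
  by apply: near_imply (Vnear _ Vx) => v /VP[_ []].
have dbx : cdom d (be (cfun c x)) by rewrite bex.
have H := @retract_rank R (euclid k) X be al (cfun c x) (idchart k) d mE mX sv sax
  alKx erefl ad I dbx.
have J := jacobian_near_eq E (smooth_germ_differentiable sb).
exact: etrans (esym (congr1 (fun B : 'M[R]_(k, cdim d) => \rank B) J)) H.
Qed.

End SubSpace.

(** * Submersions and preimages *)

Section Submersions.
Context {R : realType}.
Implicit Types X Y Z N : chartedSpace R.

Definition local_section X Y (f : X -> Y) (x : X) (s : Y -> X) :=
  [/\ smooth_at s (f x), s (f x) = x & \forall y \near f x, f (s y) = y].

Lemma submersion_rank_near X Y (f : X -> Y) x c d : is_manifold X ->
  is_manifold Y -> submersion f -> atlas X c -> atlas Y d -> cdom c x ->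
  cdom d (f x) -> \forall z \near x, rank_rep c d f z = cdim d.
Proof.
move=> mX mY [[cf _] rf] ac ad cx dx.
have H := continuous_near (cf x) (chart_near (manifold_chart mY ad) dx).
apply: near_imply (near_and (chart_near (manifold_chart mX ac) cx) H) => z [cz dz].
exact: rf.
Qed.

Lemma submersion_has_section X Y (f : X -> Y) x : is_manifold X ->
  is_manifold Y -> submersion f -> exists s, local_section f x s.
Proof.
move=> mX mY sf; have [sf0 _] := sf.
have [c [ac ic cx]] := manifold_cover x mX.
have [d [ad id dx]] := manifold_cover (f x) mY.
have sfx := (smoothP f mX mY).1 sf0.
have [q [v [s [_ sv ss Hs Hx]]]] := submersion_section mX mY ac ad cx dx
  (near_all x sfx) (submersion_rank_near mX mY sf ac ad cx dx).
exists (fun y => s y (v x)); split.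
- have mE := @euclid_manifold R q.
  have sp : @smooth_at R Y (prod_space Y (euclid q)) (fun y => (y, v x)) (f x).
    by apply: smooth_at_pair => //; [exact: smooth_at_id|exact: smooth_at_cst].
  exact: (smooth_at_comp mY (prod_manifold mY mE) mX sp ss).
- exact: nbhs_singleton Hx.
- have cp : {for f x, continuous (fun y : Y => (y, v x))}.
    by apply: continuous_pair; [exact: cvg_id|exact: cst_continuous].
  by apply: near_imply (continuous_near cp Hs) => y [].
Qed.

(** With the preceding lemma, makes submersions a notion free of charts, which passes easily to
    products and quotients. *)
Lemma section_submersion X Y (f : X -> Y) : is_manifold X -> is_manifold Y ->
  (forall x, smooth_at f x) -> (forall x, exists s, local_section f x s) ->
  submersion f.
Proof.
move=> mX mY sf sec; split; first exact/smoothP.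
move=> c d x ac ad cx dx; have [s [ss sx fs]] := sec x.
exact: section_rank fs ac ad cx dx.
Qed.

Lemma submersion_prod X X' Y Y' (f : X -> X') (g : Y -> Y') : is_manifold X ->
  is_manifold X' -> is_manifold Y -> is_manifold Y' -> submersion f ->
  submersion g ->
  @submersion R (prod_space X Y) (prod_space X' Y') (fun p => (f p.1, g p.2)).
Proof.
move=> mX mX' mY mY' sf sg.
have mP := prod_manifold mX mY; have mP' := prod_manifold mX' mY'.
have sf0 := (smoothP f mX mX').1 sf.1; have sg0 := (smoothP g mY mY').1 sg.1.
apply: section_submersion => //.
  move=> p; apply: smooth_at_pair => //.
    exact: (smooth_at_comp mP mX mX' (smooth_at_fst p mX mY)).
  exact: (smooth_at_comp mP mY mY' (smooth_at_snd p mX mY)).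
move=> [x y]; have [s [ss sx fs]] := submersion_has_section x mX mX' sf.
have [r [sr rx gr]] := submersion_has_section y mY mY' sg.
exists (fun p => (s p.1, r p.2)); split => /=.
- apply: smooth_at_pair => //.
    by apply: (smooth_at_comp mP' mX' mX (smooth_at_fst _ mX' mY')).
  by apply: (smooth_at_comp mP' mY' mY (smooth_at_snd _ mX' mY')).
- by rewrite sx rx.
- have H1 := @near_fst _ _ (f x, g y) (fun y => f (s y) = y) fs.
  have H2 := @near_snd _ _ (f x, g y) (fun y => g (r y) = y) gr.
  by apply: near_imply (near_and H1 H2) => -[a b] /= [-> ->].
Qed.

(* A is the preimage by pi of the image of nu, which is a smooth retract.  Take
   coordinates (y, v) of Z adapted to pi; then A is parametrized by (n, v)
   with y = nu n. *)
Lemma preimage_chart Z Y N (pi : Z -> Y) (nu : N -> Y) (ka : Y -> N)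
    (A : set Z) (z0 : set_type A) c d e :
  is_manifold Z -> is_manifold Y -> is_manifold N -> submersion pi ->
  (forall n, smooth_at nu n) -> (forall y, smooth_at ka y) -> cancel nu ka ->
  (forall z, A z <-> nu (ka (pi z)) = pi z) ->
  atlas Z c -> atlas Y d -> atlas N e ->
  let z := set_val z0 in cdom c z -> cdom d (pi z) -> cdom e (ka (pi z)) ->
  exists c', [/\ atlas (sub_space A) c', cdom c' z0 &
    (cdim c' + cdim d = cdim c + cdim e)%N].
Proof.
move=> mZ mY mN spi snu ska nuK AE ac ad ae z cz dz ez.
have ie := manifold_chart mN ae.
have spi0 := (smoothP pi mZ mY).1 spi.1.
have [q [v [s [nE sv ss Hs Hx]]]] := submersion_section mZ mY ac ad cz dz
  (near_all z spi0) (submersion_rank_near mZ mY spi ac ad cz dz).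
have Az : nu (ka (pi z)) = pi z by apply/AE; exact: set_val_in.
have mE n := @euclid_manifold R n.
pose k := (cdim e + q)%N.
pose al (z : Z) : 'rV[R]_k := row_mx (cfun e (ka (pi z))) (v z).
pose y_ (n : 'rV[R]_k) : Y := nu (cinv e (lsubmx n)).
pose be (n : 'rV[R]_k) : Z := s (y_ n) (rsubmx n).
have y0 : y_ (al z) = pi z by rewrite /y_ /al row_mxKl cinvK.
have skapi : smooth_at (ka \o pi) z by exact: smooth_at_comp (spi0 z) (ska _).
have sal : @smooth_at R Z (euclid k) al z.
  apply: smooth_at_row_mx => //.
  exact: (smooth_at_comp mZ mN (mE _) skapi (smooth_at_cfun mN ae ez)).
have sl : @smooth_at R (euclid k) (euclid (cdim e)) (fun n => lsubmx n) (al z).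
  by apply/smooth_at_germ; exact: smooth_germ_lsubmx.
have sr : @smooth_at R (euclid k) (euclid q) (fun n => rsubmx n) (al z).
  by apply/smooth_at_germ; exact: smooth_germ_rsubmx.
have scl : @smooth_at R (euclid k) N (fun n => cinv e (lsubmx n)) (al z).
  apply: (smooth_at_comp (mE k) (mE _) mN sl).
  by rewrite /al row_mxKl; exact: smooth_at_cinv.
have sy : @smooth_at R (euclid k) Y y_ (al z).
  exact: (smooth_at_comp (mE k) mN mY scl (snu _)).
have mP := prod_manifold mY (mE q).
have syb : @smooth_at R (euclid k) (prod_space Y (euclid q))
    (fun n => (y_ n, rsubmx n)) (al z) by exact: smooth_at_pair.
have yb0 : (y_ (al z), rsubmx (al z)) = (pi z, v z) by rewrite y0 /al row_mxKr.
have sbe : @smooth_at R (euclid k) Z be (al z).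
  apply: (@smooth_at_comp R (euclid k) (prod_space Y (euclid q)) Z
    (fun n => (y_ n, rsubmx n)) (fun p => s p.1 p.2)) => //.
  by rewrite yb0.
have be0 : be (al z) = z.
  by rewrite /be y0 /al row_mxKr; exact: nbhs_singleton Hx.
have [c' [ac' cz0 kE]] : exists c', [/\ atlas (sub_space A) c',
  cdom c' z0 & cdim c' = k].
  apply: (@retract_chart R Z A k al be z0) => //.
  - have cyb := smooth_at_continuous (mE k) mP syb.
    rewrite -yb0 in Hs.
    have H1 := continuous_near cyb Hs.
    have H2 : \forall l \near lsubmx (al z), cdom e (cinv e l) /\ cfun e (cinv e l) = l.
      by rewrite /al row_mxKl; exact: cimage_near.
    have H3 := continuous_near (smooth_germ_continuous (smooth_germ_lsubmx (al z))) H2.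
    apply: near_imply (near_and H1 H3) => n /= [[pE vE] [_ cE]]; split.
      by rewrite /al /be pE vE /y_ nuK cE hsubmxK.
    by apply/AE; rewrite /be pE /y_ nuK.
  - have H := continuous_near (smooth_at_continuous mZ mN skapi) (chart_near ie ez).
    apply: near_imply (near_and H Hx) => x [/= ex sx] /AE Ax.
    by rewrite /be /y_ /al row_mxKl row_mxKr cinvK// Ax.
by exists c'; split=> //; rewrite kE nE /k addnC (addnC (cdim e)) addnA.
Qed.

Lemma preimage_embedded Z Y N (pi : Z -> Y) (nu : N -> Y) (ka : Y -> N)
    (A : set Z) : is_manifold Z -> is_manifold Y -> is_manifold N ->
  submersion pi -> (forall n, smooth_at nu n) -> (forall y, smooth_at ka y) ->
  cancel nu ka -> (forall z, A z <-> nu (ka (pi z)) = pi z) -> embedded A.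
Proof.
move=> mZ mY mN spi snu ska nuK AE z0.
have [c [ac _ cz]] := manifold_cover (set_val z0) mZ.
have [d [ad _ dz]] := manifold_cover (pi (set_val z0)) mY.
have [e [ae _ ez]] := manifold_cover (ka (pi (set_val z0))) mN.
have [c' [ac' cz' _]] := preimage_chart mZ mY mN spi snu ska nuK AE ac ad ae cz dz ez.
by exists c'.
Qed.

(** Composable pairs are the preimage of the diagonal under the submersion s x t, and [snd] retracts
    onto the diagonal. *)
Lemma composable_embedded (M G : chartedSpace R) (s t : G -> M) :
  is_manifold M -> is_manifold G -> submersion s -> submersion t ->
  embedded (composable s t).
Proof.
move=> mM mG ss st; have mMM := prod_manifold mM mM.
apply: (@preimage_embedded (prod_space G G) (prod_space M M) M
  (fun p => (s p.1, t p.2)) (fun x => (x, x)) snd) => //.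
- exact: prod_manifold.
- exact: submersion_prod.
- by move=> x; apply: smooth_at_pair => //; exact: smooth_at_id.
- by move=> y; exact: smooth_at_snd.
- by move=> [g h]; split=> [/= ->//|[]].
Qed.

End Submersions.

(** * The rank of the anchor map *)

(** By dimension the rows of [I] span the kernel of [S]; the kernel of [row_mx S T] is that of [T]
    restricted to it, and rank-nullity concludes. Applied to [S] = ds, [T] = dt and the inclusion
    [I] of the tangent space of a source fibre. *)
Lemma rank_row_mx_ker (F : fieldType) k n m m' (I : 'M[F]_(k, n))
    (S : 'M[F]_(n, m)) (T : 'M[F]_(n, m')) : (k + m = n)%N -> \rank I = k ->
  \rank S = m -> I *m S = 0 -> \rank (row_mx S T) = (m + \rank (I *m T))%N.
Proof.
move=> kmn rI rS IS.
have IK : (I <= kermx S)%MS by apply/sub_kermxP.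
have rK : \rank (kermx S) = k by rewrite mxrank_ker rS -kmn addnK.
have KI : (kermx S <= I)%MS by rewrite -(mxrank_leqif_sup IK) rI rK.
have IKe : (I :=: kermx S)%MS by apply/eqmxP; rewrite IK KI.
have kerE : (kermx (row_mx S T) :=: kermx S :&: kermx T)%MS.
  apply/eqmxP/andP; split; apply/rV_subP => u.
    rewrite sub_capmx => /sub_kermxP; rewrite mul_mx_row.
    by move=> /eqP; rewrite row_mx_eq0 => /andP[/eqP uS /eqP uT];
      apply/andP; split; apply/sub_kermxP.
  rewrite sub_capmx => /andP[/sub_kermxP uS /sub_kermxP uT].
  by apply/sub_kermxP; rewrite mul_mx_row uS uT row_mx0.
have E1 := mxrank_mul_ker (kermx S) T.
have E2 := mxrank_ker (row_mx S T).
have E3 : \rank (kermx (row_mx S T)) = \rank (kermx S :&: kermx T)%MS := kerE.1.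
have E4 : \rank (I *m T) = \rank (kermx S *m T) := (eqmxMr T IKe).1.
have E5 := rank_leq_row (row_mx S T).
rewrite E3 in E2; rewrite E2 -E4 rK in E1.
lia.
Qed.

Section RegularGroupoid.
Context {R : realType} {M : chartedSpace R}.
Hypothesis mM : is_manifold M.
Implicit Type G : lieGroupoid M.

Lemma src_smooth G (g : G) : @smooth_at R G M (@src R M G) g.
Proof. exact: ((smoothP _ (arrows_manifold G) mM).1 (src_submersion G).1 g). Qed.

Lemma tgt_smooth G (g : G) : @smooth_at R G M (@tgt R M G) g.
Proof. exact: ((smoothP _ (arrows_manifold G) mM).1 (tgt_submersion G).1 g). Qed.

Lemma anchor_smooth G (g : G) :
  @smooth_at R G (prod_space M M) (fun h => (src h, tgt h)) g.
Proof.
exact: (smooth_at_pair mM mM (arrows_manifold G) (src_smooth g) (tgt_smooth g)).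
Qed.

Lemma anchor_rank G (r : M -> nat) (g : G) c d d' :
  (forall (x : M) (g : sub_space (src_fiber G x)),
      @has_rank_at R (sub_space (src_fiber G x)) M
        (fun h => tgt (set_val h)) g (r x)) ->
  atlas G c -> atlas M d -> atlas M d' -> cdom c g -> cdom d (src g) ->
  cdom d' (tgt g) ->
  rank_rep c (prod_chart d d') (fun h : G => (src h, tgt h)) g =
  (cdim d + r (src g))%N.
Proof.
move=> rk ac ad ad' cg dg dg'.
have mG := arrows_manifold G; have mE := @euclid_manifold R 0.
pose x := src g; pose A := src_fiber G x.
have Ag : A g by [].
pose g0 : set_type A := exist _ g (mem_set Ag).
have ic := manifold_chart mG ac.
have AE (z : G) : A z <-> x = src z by split=> /esym.
(* The source fibre is handled as the preimage of a point, the point being the image of the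
   zero-dimensional manifold [euclid 0]. *)
have nuK : cancel (fun _ : euclid 0 => x) (fun _ : M => 0 : 'rV[R]_0).
  by move=> v; rewrite [v]thinmx0.
have [|||c' [ac' cg' kE]] := @preimage_chart R G M (euclid 0) (@src R M G)
  (fun=> x) (fun=> 0)
  A g0 c d (idchart 0) mG mM mE (src_submersion G)
  (fun n => smooth_at_cst n x mE mM) (fun y => smooth_at_cst y _ mM mE) nuK AE ac ad
  erefl.
- exact: cg.
- exact: dg.
- by [].
have eA : embedded A.
  exact: (@preimage_embedded R G M (euclid 0) (@src R M G) (fun=> x) (fun=> 0)
    A mG mM mE
    (src_submersion G) (fun n => smooth_at_cst n x mE mM)
    (fun y => smooth_at_cst y _ mM mE) nuK AE).
have mA := sub_manifold mG eA.
have ic' := ac'.1.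
have sv := smooth_at_chart_smooth mA mG (smooth_at_set_val g0 mG eA) ac' ac cg' cg.
have ss := smooth_at_chart_smooth mG mM (src_smooth g) ac ad cg dg.
have st := smooth_at_chart_smooth mG mM (tgt_smooth g) ac ad' cg dg'.
have [_ _ sS] := ss; have [_ _ sT] := st.
have E1 : 'J (local_rep c (prod_chart d d') (fun h : G => (src h, tgt h))) (cfun c g) =
  row_mx ('J (local_rep c d (@src R M G)) (cfun c g))
         ('J (local_rep c d' (@tgt R M G)) (cfun c g)).
  exact: jacobian_row_mx (smooth_germ_differentiable sS)
    (smooth_germ_differentiable sT).
have E2 := jacobian_rep_comp ic' ic sv ss.
have E3 := jacobian_rep_comp ic' ic sv st.
have J0 : 'J (local_rep c' d (@src R M G \o @set_val G A)) (cfun c' g0) = 0.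
  have C0 : is_diff (cfun c' g0) (fun _ : 'rV[R]_(cdim c') => cfun d x) (mulmxr 0).
    apply: DiffDef; first exact: differentiable_cst.
    by rewrite (diff_cst (cfun d x)); apply/funext => v /=; rewrite mulmx0.
  rewrite -(is_diff_jacobian C0); apply/esym.
  apply: jacobian_near_eq; last exact: differentiable_cst.
  by apply: near_all => v; rewrite /local_rep /= (set_val_in (cinv c' v)).
rewrite J0 in E2.
have rI : \rank ('J (local_rep c' c (@set_val G A)) (cfun c' g0)) = cdim c'.
  exact: (ac'.2 _ ac).2 cg' cg.
have rS : \rank ('J (local_rep c d (@src R M G)) (cfun c g)) = cdim d.
  exact: (src_submersion G).2 ac ad cg dg.
have rT : \rank ('J (local_rep c' d' (@tgt R M G \o @set_val G A)) (cfun c' g0)) = r x.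
  exact: rk ac' ad' cg' dg'.
have kE' : (cdim c' + cdim d = cdim c)%N by rewrite kE addn0.
have := rank_row_mx_ker ('J (local_rep c d' (@tgt R M G)) (cfun c g))
  kE' rI rS (esym E2).
move=> H; apply: etrans (congr1 (fun B : 'M[R]_(cdim c, cdim d + cdim d')
  => \rank B) E1) _.
apply: etrans H _.
by have /= <- := congr1 (fun B : 'M[R]_(cdim c', cdim d') => \rank B) E3; rewrite rT.
Qed.

End RegularGroupoid.

(** * The leaf space of a map of constant rank *)

(** [(u \o f, v)] identifies [W] with a product of two balls, with inverse [w]. Plaques are the
    slices where the first coordinate is fixed: [f] is constant on each by the last clause, and
    separates them since the first coordinate is a function of [f x]. *)
Definition flow_box (R : realType) (X Y : chartedSpace R) (f : X -> Y) k q
    (u : Y -> 'rV[R]_k) (v : X -> 'rV[R]_q) (w : 'rV[R]_(k + q) -> X)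
    (a0 : 'rV[R]_k) (b0 : 'rV[R]_q) (e : R) (W : set X) :=
  [/\ 0 < e, open W,
    forall x, W x -> [/\ ball a0 e (u (f x)), ball b0 e (v x),
      w (row_mx (u (f x)) (v x)) = x, @smooth_at R Y (euclid k) u (f x) &
      @smooth_at R X (euclid q) v x],
    forall a b, ball a0 e a -> ball b0 e b ->
      [/\ W (w (row_mx a b)), u (f (w (row_mx a b))) = a,
        v (w (row_mx a b)) = b & @smooth_at R (euclid (k + q)) X w (row_mx a b)] &
    forall a b b', ball a0 e a -> ball b0 e b -> ball b0 e b' ->
      f (w (row_mx a b)) = f (w (row_mx a b'))].

Section LeafSpace.
Context {R : realType} {X Y : chartedSpace R}.
Variables (f : X -> Y).

Definition leaf x := connected_component (f @^-1` [set f x]) x.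

Lemma leaf_refl x : leaf x x.
Proof. exact: connected_component_refl. Qed.

Lemma leaf_eq x y : leaf x y -> f y = f x.
Proof. by move/connected_component_sub. Qed.

Lemma leaf_sym x y : leaf x y -> leaf y x.
Proof. by move=> xy; rewrite /leaf (leaf_eq xy); exact: connected_component_sym. Qed.

Lemma leaf_trans y x z : leaf x y -> leaf y z -> leaf x z.
Proof.
move=> xy yz; have yz' : connected_component (f @^-1` [set f x]) y z.
  by rewrite -(leaf_eq xy).
exact: connected_component_trans xy yz'.
Qed.

Lemma leaf_connected x y (B : set X) : connected B -> B x -> B y ->
  (forall z, B z -> f z = f x) -> leaf x y.
Proof. by move=> cB Bx By Bf; exists B. Qed.

Definition leaf_rel : rel X := fun x y => `[< leaf x y >].

Lemma leaf_rel_refl : reflexive leaf_rel.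
Proof. by move=> x; apply/asboolP; exact: leaf_refl. Qed.

Lemma leaf_rel_sym : ssrbool.symmetric leaf_rel.
Proof. by move=> x y; apply/asboolP/asboolP; exact: leaf_sym. Qed.

Lemma leaf_rel_trans : ssrbool.transitive leaf_rel.
Proof.
by move=> y x z /asboolP xy /asboolP yz; apply/asboolP; exact: leaf_trans yz.
Qed.

Definition leaf_equiv := EquivRel leaf_rel leaf_rel_refl leaf_rel_sym leaf_rel_trans.

Definition leaf_type := {eq_quot leaf_equiv}%qT.

Definition leaf_quotient : topologicalType := quotient_topology leaf_type.

Definition leaf_proj : X -> leaf_quotient := (\pi_leaf_type)%qT.
(** An arbitrary choice of a point in each leaf, with no continuity; only expressions depending on
    the leaf alone, such as [f (leaf_repr l)], are used as smooth functions. *)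
Definition leaf_repr : leaf_quotient -> X := fun q => repr (q : leaf_type).

Lemma leaf_reprK q : leaf_proj (leaf_repr q) = q.
Proof. exact: reprK. Qed.

Lemma leaf_projP x y : leaf_proj x = leaf_proj y <-> leaf x y.
Proof.
by split=> [/eqmodP/asboolP//|xy]; apply/eqmodP/asboolP.
Qed.

Lemma leaf_proj_continuous : continuous leaf_proj.
Proof. exact: pi_continuous. Qed.

Lemma leaf_open (U : set leaf_quotient) : open U <-> open (leaf_proj @^-1` U).
Proof. by []. Qed.

Lemma leaf_repr_image x : f (leaf_repr (leaf_proj x)) = f x.
Proof. by apply: leaf_eq; apply/leaf_projP; rewrite leaf_reprK. Qed.


Definition boxed := forall x0, exists k q (u : Y -> 'rV[R]_k) (v : X -> 'rV[R]_q)
  w a0 b0 e W,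
  flow_box f u v w a0 b0 e W /\ W x0.

Hypotheses (mX : is_manifold X) (mY : is_manifold Y).
Hypotheses (sf : forall x, smooth_at f x) (bf : boxed).

Let f_cont x : {for x, continuous f} := smooth_at_continuous mX mY (sf x).

(** Equal values of [f] give equal transverse coordinates, so the two points are joined by a segment
    in one plaque, on which [f] is constant. *)
Lemma plaque_leaf k q u v w a0 b0 e W x y : @flow_box R X Y f k q u v w a0 b0 e W ->
  W x -> W y -> f x = f y -> leaf x y.
Proof.
move=> [e0 oW HW Hw Hf] Wx Wy fxy.
have [ax bx wx _ _] := HW _ Wx; have [_ by_ wy _ _] := HW _ Wy.
pose g (t : R) := w (row_mx (u (f x)) (t *: (v y - v x) + v x)).
have seg (t : R) : t \in `[0, 1] -> ball b0 e (t *: (v y - v x) + v x).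
  by rewrite in_itv => t01; exact: ball_segment.
have cg : {within `[0, 1], continuous g}.
  apply: continuous_in_subspaceT => t; rewrite inE => t01.
  have [_ _ _ sw] := Hw _ _ ax (seg _ t01).
  have cw := smooth_at_continuous (euclid_manifold _) mX sw.
  have cl : {for t, continuous (fun t : R => row_mx (u (f x)) (t *: (v y - v x)
    + v x))}.
    apply: continuous_row_mx; first exact: cst_continuous.
    apply: continuousD; last exact: cst_continuous.
    exact: scalel_continuous.
  exact: (continuous_comp cl cw).
have cC := connected_continuous_connected (@segment_connected R 0 1) cg.
apply: (leaf_connected cC).
- exists 0; first by rewrite /= in_itv /= lexx ler01.
  by rewrite /g scale0r add0r.
- exists 1; first by rewrite /= in_itv /= lexx ler01.
  by rewrite /g scale1r subrK fxy.
- move=> _ [t t01 <-]; rewrite /g (Hf _ _ (v x) ax (seg _ t01) bx).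
  by rewrite wx.
Qed.

(* The interior of the saturation of V is relatively closed in each leaf, since
   sliding along the plaques of a flow box preserves it. *)
Lemma leaf_proj_open (V : set X) : open V -> open (leaf_proj @` V).
Proof.
move=> oV; apply/leaf_open.
set S := _ @^-1` _.
have SP x : S x <-> exists2 y, V y & leaf x y.
  split=> [[y Vy /leaf_projP /leaf_sym xy]|[y Vy xy]]; first by exists y.
  by exists y => //; apply/leaf_projP/leaf_sym.
have VS : V `<=` S by move=> x Vx; apply/SP; exists x => //; exact: leaf_refl.
suff H x : V x -> leaf x `<=` interior S.
  rewrite openE => x /SP[y Vy xy]; apply: (H y Vy); exact: leaf_sym.
move=> Vx.
have -> : leaf x = leaf x `&` interior S; last by move=> y [].
apply/esym/component_connected.
- exists x; split; first exact: leaf_refl.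
  by apply: filterS VS _; exact: open_nbhs_nbhs.
- by exists (interior S) => //; exact: open_interior.
(* The closure of the trace, as the complement of all open sets that miss it. *)
exists (~` (\bigcup_(U in [set U | open U /\ U `&` (leaf x `&` interior S) = set0]) U)).
  by apply: open_closedC; apply: bigcup_open => U [].
apply/seteqP; split=> y [xy yS]; split=> //.
  move=> [U [_ U0] Uy]; suff : set0 y by [].
  by rewrite -U0.
have [k [q [u [v [w [a0 [b0 [e [W [bW Wy]]]]]]]]]] := bf y.
have [e0 oW HW Hw Hf] := bW.
have [z [Wz [xz zS]]] : W `&` (leaf x `&` interior S) !=set0.
  apply/set0P/eqP => W0; apply: yS; exists W => //.
have fyz : f y = f z by rewrite (leaf_eq xy) (leaf_eq xz).
have [ay by_ wy suy svy] := HW _ Wy; have [az bz wz _ _] := HW _ Wz.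
have cu := smooth_at_continuous mY (euclid_manifold k) suy.
have cuf := continuous_comp (@f_cont y) cu.
(* [h] slides a point along its plaque to the level of [z]. It takes [y] to [z], which is interior
   to the saturation, so it takes points near [y] into the saturation. *)
pose h y' := w (row_mx (u (f y')) (v z)).
have hy : h y = z by rewrite /h fyz wz.
have cr : {for y, continuous (fun y' => row_mx (u (f y')) (v z))}.
  by apply: continuous_row_mx => //; exact: cst_continuous.
have [_ _ _ sw] := Hw _ _ ay bz.
have ch : {for y, continuous h}.
  exact: (continuous_comp cr (smooth_at_continuous (euclid_manifold _) mX sw)).
have nh : \forall y' \near y, S (h y').
  by apply: (continuous_near ch); rewrite hy.
apply: near_imply (near_and nh (near_open oW Wy)) => y' [/SP[t Vt ht] Wy'].
apply/SP; exists t => //; apply: leaf_trans ht.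
have [ay' by' wy' _ _] := HW _ Wy'.
have [Wh fh _ _] := Hw _ _ ay' bz.
apply: (plaque_leaf bW Wy' Wh).
by rewrite -[in LHS]wy'; exact: Hf.
Qed.

(** The inverse runs through the transversal of the box at level [b0]. *)
Definition leaf_chart k q (u : Y -> 'rV[R]_k) (w : 'rV[R]_(k + q) -> X)
    (b0 : 'rV[R]_q) (W : set X) : chart R leaf_quotient :=
  Chart (leaf_proj @` W) (fun l => u (f (leaf_repr l)))
    (fun a => leaf_proj (w (row_mx a b0))).

Definition leaf_space : chartedSpace R :=
  @ChartedSpace R leaf_quotient [set c | exists k q (u : Y -> 'rV[R]_k)
    (v : X -> 'rV[R]_q) w a0 b0 e W,
    flow_box f u v w a0 b0 e W /\ c = leaf_chart u w b0 W].

(** The quotient topology yields only global continuity; the pointwise form rests on the projection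
    being open. *)
Lemma continuous_leaf (T : topologicalType) (h : leaf_quotient -> T) x :
  {for x, continuous (h \o leaf_proj)} -> {for leaf_proj x, continuous h}.
Proof.
move=> ch U nU; have := @continuous_near _ _ _ _ U ch nU.
rewrite -nbhs_nearE nbhsE => -[V [oV Vx] VU].
suff : nbhs (leaf_proj x) (h @^-1` U) by [].
rewrite nbhsE; exists (leaf_proj @` V).
  by split; [exact: leaf_proj_open|exists x].
by move=> _ [y Vy <-]; exact: VU.
Qed.

Lemma flow_box_leaf k q u v w a0 b0 e W x b :
  @flow_box R X Y f k q u v w a0 b0 e W -> W x -> ball b0 e b ->
  leaf_proj (w (row_mx (u (f x)) b)) = leaf_proj x.
Proof.
move=> bW Wx eb; have [_ _ HW Hw Hf] := bW.
have [ax bx wx _ _] := HW _ Wx; have [Wb _ _ _] := Hw _ _ ax eb.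
apply/leaf_projP; apply: (plaque_leaf bW Wb Wx).
by rewrite -[in RHS]wx; exact: Hf.
Qed.

Lemma leaf_chart_is_chart k q u v w a0 b0 e W :
  @flow_box R X Y f k q u v w a0 b0 e W -> is_chart (leaf_chart u w b0 W).
Proof.
move=> bW; have [e0 oW HW Hw Hf] := bW.
have imE : cfun (leaf_chart u w b0 W) @` cdom (leaf_chart u w b0 W) = ball a0 e.
  apply/seteqP; split=> [_ [_ [x Wx <-] <-]|a ea] /=.
    by rewrite leaf_repr_image; have [] := HW _ Wx.
  have [Wa fa _ _] := Hw _ _ ea (ballxx b0 e0).
  exists (leaf_proj (w (row_mx a b0))); first by exists (w (row_mx a b0)).
  by rewrite leaf_repr_image.
split.
- exact: leaf_proj_open.
- by rewrite imE; exact: ball_open.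
- move=> _ [x Wx <-] /=; rewrite leaf_repr_image.
  exact: (flow_box_leaf bW Wx (ballxx b0 e0)).
- move=> _ [x Wx <-]; apply: continuous_leaf.
  have [_ _ _ su _] := HW _ Wx.
  have C := continuous_comp (@f_cont x) (smooth_at_continuous mY (euclid_manifold k) su).
  apply: continuous_near_eq C.
  by apply: near_all => y /=; rewrite leaf_repr_image.
- rewrite imE => a ea; have [_ _ _ sw] := Hw _ _ ea (ballxx b0 e0).
  have cr : {for a, continuous (fun a => row_mx a b0)}.
    by apply: continuous_row_mx; [exact: cvg_id|exact: cst_continuous].
  have cw := continuous_comp cr (smooth_at_continuous (euclid_manifold _) mX sw).
  exact: (continuous_comp cw (@leaf_proj_continuous _)).
Qed.

Lemma flow_box_u_smooth k q u v w a0 b0 e W x :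
  @flow_box R X Y f k q u v w a0 b0 e W -> W x ->
  @smooth_at R X (euclid k) (u \o f) x.
Proof.
move=> [_ _ HW _ _] Wx; have [_ _ _ su _] := HW _ Wx.
exact: (smooth_at_comp mX mY (euclid_manifold k) (sf x) su).
Qed.

Lemma flow_box_w_smooth k q u v w a0 b0 e W a b :
  @flow_box R X Y f k q u v w a0 b0 e W -> ball a0 e a -> ball b0 e b ->
  @smooth_at R (euclid k) X (fun a => w (row_mx a b)) a.
Proof.
move=> [_ _ _ Hw _] ea eb; have [_ _ _ sw] := Hw _ _ ea eb.
have sr : @smooth_at R (euclid k) (euclid (k + q)) (fun a => row_mx a b) a.
  by apply/smooth_at_germ; apply: smooth_germ_row_mx; [exact: smooth_germ_id|exact:
    smooth_germ_cst].
exact: (smooth_at_comp (euclid_manifold k) (euclid_manifold _) mX sr sw).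
Qed.

Lemma leaf_space_manifold : is_manifold leaf_space.
Proof.
split.
- move=> _ [k [q [u [v [w [a0 [b0 [e [W [bW ->]]]]]]]]]].
  exact: (leaf_chart_is_chart bW).
- move=> l; have [k [q [u [v [w [a0 [b0 [e [W [bW Wl]]]]]]]]]] := bf (leaf_repr l).
  exists (leaf_chart u w b0 W).
    by exists k, q, u, v, w, a0, b0, e, W.
  by exists (leaf_repr l) => //; exact: leaf_reprK.
- move=> _ _ [k [q [u [v [w [a0 [b0 [e [W [bW ->]]]]]]]]]]
    [k' [q' [u' [v' [w' [a0' [b0' [e' [W' [bW' ->]]]]]]]]]].
  have ic := leaf_chart_is_chart bW; have ic' := leaf_chart_is_chart bW'.
  apply: chart_smooth_smooth_rep => // l lW lW'; split => //.
    exact: (chart_near ic' lW').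
  have [x Wx xl] := lW; have [x' Wx' xl'] := lW'.
  have [e0 oW HW Hw Hf] := bW; have [ax bx wx su sv] := HW _ Wx.
  (* The two boxes may be disjoint, but [f] takes one value on the common leaf. Hence the transition
     map is [u' \o f] applied to the transversal of the first box, and no motion along the leaf is
     involved. *)
  have fxx' : f x' = f x by rewrite -(leaf_repr_image x) -(leaf_repr_image x') xl xl'.
  have E : cfun (leaf_chart u w b0 W) l = u (f x) by rewrite /= -xl leaf_repr_image.
  rewrite E; have sw := flow_box_w_smooth bW ax (ballxx b0 e0).
  have fw : f (w (row_mx (u (f x)) b0)) = f x'.
    by rewrite fxx' -[in RHS]wx; exact: Hf (ballxx b0 e0) bx.
  have sfw := smooth_at_comp (euclid_manifold k) mX mY sw (sf _).
  have [_ _ HW' _ _] := bW'; have [_ _ _ su' _] := HW' _ Wx'.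
  rewrite -fw in su'.
  have := smooth_at_comp (euclid_manifold k) mY (euclid_manifold k') sfw su'.
  move=> /smooth_at_germ; apply: smooth_germ_near_eq.
  by apply: near_all => a; rewrite /local_rep /= leaf_repr_image.
Qed.

Lemma leaf_chart_at x : exists k q (u : Y -> 'rV[R]_k) (v : X -> 'rV[R]_q) w a0 b0 e W,
  [/\ flow_box f u v w a0 b0 e W, W x, atlas leaf_space (leaf_chart u w b0 W) &
      cdom (leaf_chart u w b0 W) (leaf_proj x)].
Proof.
have [k [q [u [v [w [a0 [b0 [e [W [bW Wx]]]]]]]]]] := bf x.
exists k, q, u, v, w, a0, b0, e, W; split => //; last by exists x.
by exists k, q, u, v, w, a0, b0, e, W.
Qed.

Lemma leaf_proj_smooth x : @smooth_at R X leaf_space leaf_proj x.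
Proof.
have [k [q [u [v [w [a0 [b0 [e [W [bW Wx ad dx]]]]]]]]]] := leaf_chart_at x.
have [c [ac ic cx]] := manifold_cover x mX.
have [_ _ s] := smooth_at_chart_smooth mX (euclid_manifold k)
  (flow_box_u_smooth bW Wx) ac
  erefl cx I.
exists c, (leaf_chart u w b0 W); split=> //; split=> //.
  have [_ oW _ _ _] := bW.
  by apply: near_imply (near_open oW Wx) => y Wy; exists y.
apply: smooth_germ_near_eq s.
by apply: near_all => y; rewrite /local_rep /= leaf_repr_image.
Qed.

(** The transversal through [x], at level [v x] instead of [b0], is a local section. *)
Lemma leaf_proj_section x : exists s, @local_section R X leaf_space leaf_proj x s.
Proof.
have [k [q [u [v [w [a0 [b0 [e [W [bW Wx ad dx]]]]]]]]]] := leaf_chart_at x.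
have [e0 oW HW Hw Hf] := bW; have [ax bx wx su sv] := HW _ Wx.
exists (fun l => w (row_mx (u (f (leaf_repr l))) (v x))); split.
- have sc := smooth_at_cfun leaf_space_manifold ad dx.
  have sw := flow_box_w_smooth bW ax bx.
  have E : cfun (leaf_chart u w b0 W) (leaf_proj x) = u (f x)
    by rewrite /= leaf_repr_image.
  rewrite -E in sw.
  exact: (smooth_at_comp leaf_space_manifold (euclid_manifold k) mX sc sw).
- by rewrite leaf_repr_image.
- have od : open (leaf_proj @` W) by exact: leaf_proj_open.
  apply: near_imply (near_open od dx) => _ [y Wy <-].
  by rewrite leaf_repr_image; exact: (flow_box_leaf bW Wy bx).
Qed.

Lemma leaf_proj_submersion : @submersion R X leaf_space leaf_proj.
Proof.
apply: section_submersion => //; [exact: leaf_space_manifold|exact: leaf_proj_smooth|].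
exact: leaf_proj_section.
Qed.

(** Near the leaf of [x], a local section [s] writes [h] as [h \o leaf_proj \o s]. *)
Lemma smooth_at_leaf (Z : chartedSpace R) (h : leaf_space -> Z) x : is_manifold Z ->
  @smooth_at R X Z (h \o leaf_proj) x -> @smooth_at R leaf_space Z h (leaf_proj x).
Proof.
move=> mZ sh; have [s [ss sx ps]] := leaf_proj_section x.
have sh0 : @smooth_at R X Z (h \o leaf_proj) (s (leaf_proj x)) by rewrite sx.
have H := smooth_at_comp leaf_space_manifold mX mZ ss sh0.
apply: smooth_at_near_eq H; first exact: leaf_space_manifold.
by apply: near_imply ps => l /= ->.
Qed.

Lemma leaf_proj_fiber l : leaf_proj @^-1` [set l] = leaf (leaf_repr l).
Proof.
apply/seteqP; split=> x /=; last by move=> /leaf_projP <-; exact: leaf_reprK.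
by rewrite -{1}(leaf_reprK l) => /esym /leaf_projP.
Qed.

Lemma leaf_proj_fiber_connected l : connected (leaf_proj @^-1` [set l]).
Proof. by rewrite leaf_proj_fiber; exact: component_connected. Qed.

(** Within one box, points with the same value of [f] lie in the same leaf. This is the source of
    the discreteness of the fibres of (s, t) on E. *)
Lemma leaf_factor_inj x : exists O, [/\ open O, O (leaf_proj x) &
  forall l l', O l -> O l' -> f (leaf_repr l) = f (leaf_repr l') -> l = l'].
Proof.
have [k [q [u [v [w [a0 [b0 [e [W [bW Wx ad dx]]]]]]]]]] := leaf_chart_at x.
exists (leaf_proj @` W); split => //.
  by have [_ oW _ _ _] := bW; exact: leaf_proj_open.
move=> _ _ [y Wy <-] [z Wz <-]; rewrite !leaf_repr_image => yz.
by apply/leaf_projP; exact: plaque_leaf bW Wy Wz yz.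
Qed.

(** An open continuous surjection carries a base to a base. *)
Lemma leaf_second_countable : second_countable X -> second_countable leaf_space.
Proof.
move=> [B cB [oB bB]]; exists ([set leaf_proj @` U | U in B]).
  exact: card_le_trans (card_image_le _ _) cB.
split=> [_ [U BU <-]|l V]; first exact/leaf_proj_open/oB.
rewrite nbhsE => -[D [oD Dl] DV].
have : nbhs (leaf_repr l) (leaf_proj @^-1` D).
  apply: open_nbhs_nbhs; split; first exact/leaf_open.
  by rewrite /= leaf_reprK.
move=> /(bB _)[U [BU Ul] UD]; exists (leaf_proj @` U).
  split; first by exists U.
  by exists (leaf_repr l) => //; exact: leaf_reprK.
by move=> _ [y Uy <-]; apply: DV; exact: UD.
Qed.

End LeafSpace.

(** * The quotient groupoid *)

Section GroupoidCalculus.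
Context {R : realType} {M : chartedSpace R}.
Hypothesis mM : is_manifold M.
Variable G : lieGroupoid M.

Let mG : is_manifold G := arrows_manifold G.

Definition anchor (g : G) : prod_space M M := (src g, tgt g).

Lemma ginv_smooth_at (g : G) : smooth_at (@ginv R M G) g.
Proof. exact: ((smoothP _ mG mG).1 (ginv_smooth G) g). Qed.

Lemma gunit_smooth_at (x : M) : smooth_at (gunit G) x.
Proof. exact: ((smoothP _ mM mG).1 (gunit_smooth G) x). Qed.

Let comp_set := composable (@src R M G) (@tgt R M G).

Lemma gcomp_smooth_at (Z : chartedSpace R) (f g : Z -> G) z : is_manifold Z ->
  smooth_at f z -> smooth_at g z -> (\forall y \near z, src (f y) = tgt (g y)) ->
  smooth_at (fun y => gcomp (f y) (g y)) z.
Proof.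
move=> mZ sf sg fg; have mGG := prod_manifold mG mG.
have eC := composable_embedded mM mG (src_submersion G) (tgt_submersion G).
have mC := sub_manifold mGG eC.
have Cz : comp_set (f z, g z) := nbhs_singleton fg.
pose p0 : set_type comp_set := exist _ (f z, g z) (mem_set Cz).
pose h (y : Z) : set_type comp_set := sub_of p0 (f y, g y).
have hE : \forall y \near z, (f y, g y) = set_val (h y).
  by apply: near_imply fg => y yC; rewrite sub_ofK.
have sh : @smooth_at R Z (sub_space comp_set) h z.
  apply: (smooth_at_into_sub mGG mZ eC).
  have sp := smooth_at_pair mG mG mZ sf sg.
  exact: (@smooth_at_near_eq R Z (prod_space G G) _ (set_val \o h) z mZ hE sp).
have sc := (smoothP _ mC mG).1 (gcomp_smooth G) (h z).
have H := smooth_at_comp mZ mC mG sh sc.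
by apply: smooth_at_near_eq H => //; apply: near_imply hE => y /= <-.
Qed.

(** Continuity relative to [B] is what moving an arrow along a connected subset of a leaf requires,
    as the arrows off that subset may fail to be composable. *)
Lemma gcomp_within (T : topologicalType) (B : set T) (f g : T -> G) :
  continuous f -> continuous g -> (forall b, B b -> src (f b) = tgt (g b)) ->
  {within B, continuous (fun b => gcomp (f b) (g b))}.
Proof.
move=> cf cg fg; apply/subspace_sigL_continuousP => b.
pose h (b : set_type B) : set_type comp_set :=
  exist _ (f (set_val b), g (set_val b)) (mem_set (fg _ (set_val_in b))).
have ch : {for b, continuous h}.
  apply: continuous_set_val; have cv := @set_val_continuous _ _ b.
  apply: continuous_pair.
    exact: (continuous_comp cv (cf _)).
  exact: (continuous_comp cv (cg _)).
have [cc _] := gcomp_smooth G.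
exact: (continuous_comp ch (cc (h b))).
Qed.

Lemma src_leaf (g h : G) : leaf anchor g h -> src h = src g.
Proof. by move=> /leaf_eq []. Qed.

Lemma tgt_leaf (g h : G) : leaf anchor g h -> tgt h = tgt g.
Proof. by move=> /leaf_eq []. Qed.

(** Composition with a fixed arrow maps a connected subset of a fibre of the anchor onto another
    one; [h] and [g] are moved in turn. *)
Lemma leaf_gcomp (h h' g g' : G) : src h = tgt g -> leaf anchor h h' ->
  leaf anchor g g' -> leaf anchor (gcomp h g) (gcomp h' g').
Proof.
move=> hg hh' gg'.
have ci : continuous (fun k : G => k) by move=> x; exact: cvg_id.
have cc (a : G) : continuous (fun _ : G => a) by exact: cst_continuous.
apply: (@leaf_trans _ _ _ _ (gcomp h' g)).
  case: (hh') => B [Bh BF cB] Bh'.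
  have BE k : B k -> src k = src h /\ tgt k = tgt h by move=> /BF [].
  have cI := @gcomp_within G B (fun k => k) (fun=> g) ci (cc g)
    (fun k Bk => etrans (BE k Bk).1 hg).
  apply: (leaf_connected (connected_continuous_connected cB cI)).
  - by exists h.
  - by exists h'.
  - move=> _ [k Bk <-]; have [k1 k2] := BE _ Bk; rewrite /anchor.
    by rewrite !src_gcomp ?tgt_gcomp ?k1 ?k2// src_gcomp.
have h'g : src h' = tgt g by rewrite (src_leaf hh').
case: (gg') => B [Bg BF cB] Bg'.
have BE k : B k -> src k = src g /\ tgt k = tgt g by move=> /BF [].
have cI := @gcomp_within G B (fun=> h') (fun k => k) (cc h') ci
    (fun k Bk => etrans h'g (esym (BE k Bk).2)).
apply: (leaf_connected (connected_continuous_connected cB cI)).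
- by exists g.
- by exists g'.
- move=> _ [k Bk <-]; have [k1 k2] := BE _ Bk; rewrite /anchor.
  by rewrite !src_gcomp ?tgt_gcomp ?k1 ?k2.
Qed.

Lemma leaf_ginv (g g' : G) : leaf anchor g g' -> leaf anchor (ginv g) (ginv g').
Proof.
move=> [B [Bg BF cB] Bg'].
have ci : continuous (@ginv R M G) := (ginv_smooth G).1.
have cI := connected_continuous_connected cB (continuous_subspaceT ci).
apply: (leaf_connected cI).
- by exists g.
- by exists g'.
- by move=> _ [k /BF[k1 k2] <-]; rewrite /anchor !src_ginv !tgt_ginv k1 k2.
Qed.

Lemma anchor_boxed : regular G -> boxed anchor.
Proof.
move=> [r [rc rk]] g0.
have [c [ac ic cg]] := manifold_cover g0 mG.
have [d [ad id dg]] := manifold_cover (src g0) mM.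
have [d' [ad' id' dg']] := manifold_cover (tgt g0) mM.
have mMM := prod_manifold mM mM.
have aD : atlas (prod_space M M) (prod_chart d d') by exists d, d'.
have Dg : cdom (prod_chart d d') (anchor g0) by [].
have cs := smooth_at_continuous mG mM (src_smooth mM g0).
have ct := smooth_at_continuous mG mM (tgt_smooth mM g0).
have rn : \forall g \near g0,
    rank_rep c (prod_chart d d') anchor g = (cdim d + r (src g0))%N.
  have n1 := continuous_near cs (near_and (chart_near id dg) (rc (src g0))).
  have n2 := continuous_near ct (chart_near id' dg').
  apply: near_imply (near_and (chart_near ic cg) (near_and n1 n2)).
  move=> g [gc [[gd rE] gd']]; rewrite -rE.
  exact: (anchor_rank mM rk ac ad ad' gc gd gd').
have [q [P [v [w [e [W [[nE e0 rP] [oW Wx0 WN] HW Hw Hf]]]]]]] :=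
  manifold_constant_rank mG mMM ac aD cg Dg (near_all g0 (anchor_smooth mM (G :=
    G))) rn.
pose u (y : prod_space M M) := cfun (prod_chart d d') y *m P.
exists (cdim d + r (src g0))%N, q, u, v, w, (u (anchor g0)), (v g0), e, W; split=> //.
split=> //.
move=> g Wg; have [Dg' _ sv] := WN _ Wg; have [au bv wg] := HW _ Wg.
by split=> //; apply: smooth_at_mulmx => //; exact: smooth_at_cfun.
Qed.

Hypothesis bG : boxed anchor.

Let mMM : is_manifold (prod_space M M) := prod_manifold mM mM.
Let E : chartedSpace R := leaf_space anchor.
Let p : G -> E := leaf_proj anchor.
Let mE : is_manifold E := leaf_space_manifold mG mMM (anchor_smooth mM (G := G)) bG.
Let sp (g : G) : smooth_at p g :=
  leaf_proj_smooth mG mMM (anchor_smooth mM (G := G)) bG g.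

(** The structure maps of E are computed on chosen representatives; as composition and inversion
    respect leaves, any other points of the leaves give the same result. *)
Definition leaf_src (l : E) : M := src (leaf_repr l).
Definition leaf_tgt (l : E) : M := tgt (leaf_repr l).
Definition leaf_comp (l m : E) : E := p (gcomp (leaf_repr l) (leaf_repr m)).
Definition leaf_unit (x : M) : E := p (gunit G x).
Definition leaf_inv (l : E) : E := p (ginv (leaf_repr l)).

Lemma leaf_proj_ex (l : E) : exists g, l = p g.
Proof. by exists (leaf_repr l); rewrite /p leaf_reprK. Qed.

Lemma leaf_repr_proj g : leaf anchor (leaf_repr (p g)) g.
Proof. by apply/leaf_projP; rewrite leaf_reprK. Qed.

Lemma leaf_srcE g : leaf_src (p g) = src g.
Proof. exact: esym (src_leaf (leaf_repr_proj g)). Qed.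

Lemma leaf_tgtE g : leaf_tgt (p g) = tgt g.
Proof. exact: esym (tgt_leaf (leaf_repr_proj g)). Qed.

Lemma leaf_compE h g : src h = tgt g -> leaf_comp (p h) (p g) = p (gcomp h g).
Proof.
move=> hg; apply/leaf_projP; apply: leaf_gcomp; try exact: leaf_repr_proj.
by have := leaf_srcE h; have := leaf_tgtE g; rewrite /leaf_src /leaf_tgt => -> ->.
Qed.

Lemma leaf_invE g : leaf_inv (p g) = p (ginv g).
Proof. by apply/leaf_projP; apply: leaf_ginv; exact: leaf_repr_proj. Qed.

Lemma smooth_at_leaf_factor (Z : chartedSpace R) (h : E -> Z) (h' : G -> Z) (l : E) :
  is_manifold Z -> (forall g, h (p g) = h' g) -> (forall g, smooth_at h' g) ->
  smooth_at h l.
Proof.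
move=> mZ hh sh; have [g ->] := leaf_proj_ex l.
apply: (smooth_at_leaf mG mMM (anchor_smooth mM (G := G)) bG mZ).
by rewrite (_ : _ \o _ = h') //; apply/funext => k; exact: hh.
Qed.

Lemma leaf_src_smooth l : @smooth_at R E M leaf_src l.
Proof. apply: (smooth_at_leaf_factor _ mM leaf_srcE) => g; exact: src_smooth. Qed.

Lemma leaf_tgt_smooth l : @smooth_at R E M leaf_tgt l.
Proof. apply: (smooth_at_leaf_factor _ mM leaf_tgtE) => g; exact: tgt_smooth. Qed.

Lemma leaf_inv_smooth l : @smooth_at R E E leaf_inv l.
Proof.
apply: (smooth_at_leaf_factor _ mE leaf_invE) => g.
exact: (smooth_at_comp mG mG mE (ginv_smooth_at g) (sp _)).
Qed.

Lemma leaf_unit_smooth x : @smooth_at R M E leaf_unit x.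
Proof. exact: (smooth_at_comp mM mG mE (gunit_smooth_at x) (sp _)). Qed.

(** A local section of [h'] followed by [p] is a local section of [h]. *)
Lemma leaf_factor_submersion (h : E -> M) (h' : G -> M) : (forall g, h (p g) = h' g) ->
  submersion h' -> (forall l, smooth_at h l) -> submersion h.
Proof.
move=> hh sh' sh; apply: section_submersion => // l.
have [g ->] := leaf_proj_ex l.
have [s [ss sg hs]] := submersion_has_section g mG mM sh'.
rewrite -hh in ss sg hs.
exists (p \o s); split.
- by apply: (smooth_at_comp mM mG mE ss); exact: sp.
- by rewrite /= sg.
- by apply: near_imply hs => y /=; rewrite hh.
Qed.

Lemma leaf_src_submersion : submersion leaf_src.
Proof. exact: leaf_factor_submersion leaf_srcE (src_submersion G) leaf_src_smooth. Qed.

Lemma leaf_tgt_submersion : submersion leaf_tgt.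
Proof. exact: leaf_factor_submersion leaf_tgtE (tgt_submersion G) leaf_tgt_smooth. Qed.

(** Local sections of [p] lift composable pairs of E to composable pairs of G, since [p] preserves
    source and target; the product in E is then [p] of the product of the lifts. *)
Lemma leaf_comp_smooth : @smooth R (sub_space (composable leaf_src leaf_tgt)) E
  (fun l => leaf_comp (set_val l).1 (set_val l).2).
Proof.
have mEE := prod_manifold mE mE.
have eC := composable_embedded mM mE leaf_src_submersion leaf_tgt_submersion.
have mC := sub_manifold mEE eC.
apply/(smoothP _ mC mE) => l.
have [[h hE] [g gE]] := (leaf_proj_ex (set_val l).1, leaf_proj_ex (set_val l).2).
have sv := smooth_at_set_val l mEE eC.
have s1 := smooth_at_comp mC mEE mE sv (smooth_at_fst _ mE mE).
have s2 := smooth_at_comp mC mEE mE sv (smooth_at_snd _ mE mE).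
have [s [ss sh ps]] := leaf_proj_section mG mMM (anchor_smooth mM (G := G)) bG h.
have [t [st tg pt]] := leaf_proj_section mG mMM (anchor_smooth mM (G := G)) bG g.
have E1 : (fst \o set_val) l = p h := hE.
have E2 : (snd \o set_val) l = p g := gE.
rewrite -[leaf_proj _ _]E1 in ss ps; rewrite -[leaf_proj _ _]E2 in st pt.
have n1 := continuous_near (smooth_at_continuous mC mE s1) ps.
have n2 := continuous_near (smooth_at_continuous mC mE s2) pt.
have ss1 := smooth_at_comp mC mE mG s1 ss.
have st2 := smooth_at_comp mC mE mG s2 st.
have nC : \forall m \near l, src (s (set_val m).1) = tgt (t (set_val m).2).
  apply: near_imply (near_and n1 n2) => m [m1 m2].
  rewrite -leaf_srcE -leaf_tgtE [p (s _)]m1 [p (t _)]m2; exact: (set_val_in m).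
have sc := gcomp_smooth_at mC ss1 st2 nC.
have := smooth_at_comp mC mG mE sc (sp _).
apply: smooth_at_near_eq => //.
apply: near_imply (near_and nC (near_and n1 n2)) => m [mC' [m1 m2]] /=.
by rewrite -(leaf_compE mC') [p (s _)]m1 [p (t _)]m2.
Qed.

(** Each law is checked on arrows [p g], where it is the law of G. The definition is transparent so
    that its operations reduce to those above. *)
Definition leaf_groupoid : lieGroupoid M.
Proof.
refine (@LieGroupoid R M E leaf_src leaf_tgt leaf_comp leaf_unit leaf_inv mE leaf_src_submersion
  leaf_tgt_submersion leaf_comp_smooth ((smoothP _ mM mE).2 leaf_unit_smooth)
  ((smoothP _ mE mE).2 leaf_inv_smooth) _ _ _ _ _ _ _ _ _ _ _).
- move=> l m; have [[h ->] [g ->]] := (leaf_proj_ex l, leaf_proj_ex m).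
  by rewrite leaf_srcE leaf_tgtE => hg; rewrite leaf_compE// !leaf_srcE src_gcomp.
- move=> l m; have [[h ->] [g ->]] := (leaf_proj_ex l, leaf_proj_ex m).
  by rewrite leaf_srcE (leaf_tgtE g) => hg; rewrite leaf_compE// !leaf_tgtE tgt_gcomp.
- move=> l m n; have [[k ->] [h ->]] := (leaf_proj_ex l, leaf_proj_ex m).
  have [g ->] := leaf_proj_ex n; rewrite !leaf_srcE !leaf_tgtE => kh hg.
  by rewrite !leaf_compE ?src_gcomp ?tgt_gcomp// gcompA.
- by move=> x; rewrite leaf_srcE src_gunit.
- by move=> x; rewrite leaf_tgtE tgt_gunit.
- move=> l; have [g ->] := leaf_proj_ex l.
  by rewrite leaf_tgtE leaf_compE ?src_gunit// gcomp1g.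
- move=> l; have [g ->] := leaf_proj_ex l.
  by rewrite leaf_srcE leaf_compE ?tgt_gunit// gcompg1.
- by move=> l; have [g ->] := leaf_proj_ex l;
  rewrite leaf_invE leaf_srcE leaf_tgtE src_ginv.
- by move=> l; have [g ->] := leaf_proj_ex l;
  rewrite leaf_invE leaf_srcE leaf_tgtE tgt_ginv.
- move=> l; have [g ->] := leaf_proj_ex l.
  by rewrite leaf_invE leaf_srcE leaf_compE ?src_ginv// gcompVg.
- move=> l; have [g ->] := leaf_proj_ex l.
  by rewrite leaf_invE leaf_tgtE leaf_compE ?tgt_ginv// gcompgV.
Defined.

End GroupoidCalculus.

(** * The bundle of identity components *)

(** The corestriction to A is continuous on [B], and its image of [B] is the set in question. *)
Lemma connected_set_val (T : topologicalType) (A B : set T) (x0 : set_type A) :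
  B `<=` A -> connected B -> connected (@set_val T A @^-1` B).
Proof.
move=> BA cB.
have -> : @set_val T A @^-1` B = sub_of x0 @` B.
  apply/seteqP; split=> [x Bx|_ [y By <-]].
    exists (set_val x) => //; apply: set_val_inj; rewrite sub_ofK//.
    exact: set_val_in.
  by rewrite /preimage /= sub_ofK//; exact: BA.
apply: connected_continuous_connected cB _.
apply/subspace_sigL_continuousP => b; apply: continuous_set_val.
apply: continuous_near_eq (@set_val_continuous _ _ b).
by apply: near_all => y; rewrite /= sub_ofK//; apply: BA; exact: set_val_in.
Qed.

Section IsotropyBundle.
Context {R : realType} {M : chartedSpace R}.
Hypothesis mM : is_manifold M.
Variable G : lieGroupoid M.
Hypothesis bG : boxed (@anchor R M G).

Let mG : is_manifold G := arrows_manifold G.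
Let mMM : is_manifold (prod_space M M) := prod_manifold mM mM.
Let E : lieGroupoid M := leaf_groupoid mM bG.
Let mE : is_manifold E := arrows_manifold E.
Let p : G -> E := leaf_proj (@anchor R M G).
Let A : set G := isotropy_id_component G.

Let sp (g : G) : smooth_at p g := leaf_proj_smooth mG mMM (anchor_smooth mM (G :=
  G)) bG g.

Lemma isotropyE x : isotropy G x = @anchor R M G @^-1` [set anchor (gunit G x)].
Proof.
rewrite /anchor src_gunit tgt_gunit.
by apply/seteqP; split=> g [gs gt]; [rewrite /preimage /= gs gt|].
Qed.

(** Turns membership in an identity component into an equation in E, of the form required for the
    preimage of a section; closure under the operations is then a computation with units of E. *)
Lemma isotropy_idP g : A g <-> gunit E (src g) = p g.
Proof.
have H x : connected_component (isotropy G x) (gunit G x) = leaf (@anchor R M G)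
  (gunit G x).
  by rewrite isotropyE.
split=> [[x _]|/leaf_projP gg].
  rewrite H => xg; rewrite (src_leaf xg) src_gunit.
  exact/leaf_projP.
by exists (src g) => //; rewrite H.
Qed.

Lemma leaf_proj_src g : src (p g) = src g. Proof. exact: leaf_srcE. Qed.
Lemma leaf_proj_tgt g : tgt (p g) = tgt g. Proof. exact: leaf_tgtE. Qed.
Lemma leaf_proj_gcomp h g : src h = tgt g -> p (gcomp h g) = gcomp (p h) (p g).
Proof. by move=> hg; exact: esym (leaf_compE hg). Qed.
Lemma leaf_proj_ginv g : p (ginv g) = ginv (p g).
Proof. exact: esym (leaf_invE g). Qed.
Lemma leaf_proj_gunit x : p (gunit G x) = gunit E x. Proof. by []. Qed.

Lemma isotropy_id_src g : A g -> src g = tgt g.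
Proof. by move=> /isotropy_idP gp; rewrite -leaf_proj_tgt -gp tgt_gunit. Qed.

Lemma isotropy_id_unit x : A (gunit G x).
Proof. by apply/isotropy_idP; rewrite src_gunit leaf_proj_gunit. Qed.

Lemma isotropy_id_comp h g : src h = tgt g -> A h -> A g -> A (gcomp h g).
Proof.
move=> hg /[dup] /isotropy_id_src hh /isotropy_idP ph /[dup] /isotropy_id_src gg /isotropy_idP pg.
apply/isotropy_idP; rewrite src_gcomp// leaf_proj_gcomp// -ph -pg hg -gg.
by rewrite -[X in gcomp X _](_ : gunit E (tgt (gunit E (src g))) = _)
  ?gcomp1g ?tgt_gunit.
Qed.

Lemma isotropy_id_inv g : A g -> A (ginv g).
Proof.
move=> /[dup] /isotropy_id_src gg /isotropy_idP pg; apply/isotropy_idP.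
rewrite src_ginv -gg leaf_proj_ginv -pg -[RHS]gcompg1 src_ginv tgt_gunit.
by rewrite gcompVg src_gunit.
Qed.

Lemma isotropy_id_embedded : embedded A.
Proof.
apply: (@preimage_embedded R G E M p (gunit E) (@src R M E)) => //.
- exact: (leaf_proj_submersion mG mMM (anchor_smooth mM (G := G)) bG).
- exact: gunit_smooth_at.
- exact: src_smooth.
- exact: src_gunit.
- by move=> g; rewrite leaf_proj_src; exact: isotropy_idP.
Qed.

Let K : chartedSpace R := sub_space A.
Let mK : is_manifold K := sub_manifold mG isotropy_id_embedded.
Let val (k : K) : G := set_val k.
Let sval (k : K) : smooth_at val k := smooth_at_set_val k mG isotropy_id_embedded.

Definition bundle_src (k : K) : M := src (val k).
Definition bundle_tgt (k : K) : M := tgt (val k).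
(* The value is junk when k and l are not composable. *)
Definition bundle_comp (k l : K) : K := sub_of k (gcomp (val k) (val l)).
Definition bundle_unit (x : M) : K := exist _ (gunit G x)
  (mem_set (isotropy_id_unit x)).
Definition bundle_inv (k : K) : K :=
  exist _ (ginv (val k)) (mem_set (isotropy_id_inv (set_val_in k))).

Lemma bundle_src_tgt k : bundle_src k = bundle_tgt k.
Proof. exact: isotropy_id_src (set_val_in k). Qed.

Lemma val_bundle_comp k l : bundle_src k = bundle_tgt l -> val (bundle_comp k l)
  = gcomp (val k) (val l).
Proof.
by move=> kl; apply: sub_ofK; apply: isotropy_id_comp => //; exact: set_val_in.
Qed.

Lemma bundle_src_smooth k : @smooth_at R K M bundle_src k.
Proof. exact: (smooth_at_comp mK mG mM (sval k) (src_smooth mM _)). Qed.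

(** A local section through [k] is the unit section of E followed by a local section of [p] through
    [k]: its values are sent by [p] to units, so they stay in the bundle. *)
Lemma bundle_src_submersion : @submersion R K M bundle_src.
Proof.
apply: section_submersion => //; first exact: bundle_src_smooth.
move=> k; have [s [ss sk ps]] :=
  leaf_proj_section mG mMM (anchor_smooth mM (G := G)) bG (val k).
have pk : leaf_proj (@anchor R M G) (val k) = gunit E (bundle_src k).
  by apply/esym/isotropy_idP; exact: set_val_in.
rewrite pk in ss sk ps.
have su := gunit_smooth_at mM E (bundle_src k).
have nu := continuous_near (smooth_at_continuous mM mE su) ps.
have nA : \forall x \near bundle_src k, A (s (gunit E x)) /\ src (s (gunit E x)) = x.
  apply: near_imply nu => x px.
  have sx : src (s (gunit E x)) = x by rewrite -leaf_proj_src [p _]px src_gunit.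
  by split=> //; apply/isotropy_idP; rewrite sx [p _]px.
exists (fun x => sub_of k (s (gunit E x))); split.
- apply: (smooth_at_into_sub mG mM isotropy_id_embedded).
  have ssu := smooth_at_comp mM mE mG su ss.
  apply: (@smooth_at_near_eq R M G _ _ _ mM _ ssu).
  by apply: near_imply nA => x [Ax _] /=; rewrite sub_ofK.
- by rewrite sk; apply: set_val_inj; rewrite sub_ofK//; exact: set_val_in.
- by apply: near_imply nA => x [Ax sx]; rewrite /bundle_src /val sub_ofK.
Qed.

Lemma bundle_tgt_submersion : @submersion R K M bundle_tgt.
Proof.
by rewrite (_ : bundle_tgt = bundle_src); [exact:
  bundle_src_submersion|apply/funext => k; rewrite bundle_src_tgt].
Qed.

Lemma bundle_comp_smooth : @smooth R (sub_space (composable bundle_src bundle_tgt)) K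
  (fun l => bundle_comp (set_val l).1 (set_val l).2).
Proof.
have mKK := prod_manifold mK mK.
have eC := composable_embedded mM mK bundle_src_submersion bundle_tgt_submersion.
have mC := sub_manifold mKK eC.
apply/(smoothP _ mC mK) => l.
apply: (smooth_at_into_sub mG mC isotropy_id_embedded).
have sv := smooth_at_set_val l mKK eC.
have s1 := smooth_at_comp mC mK mG (smooth_at_comp mC mKK mK sv (smooth_at_fst _ mK mK)) (sval _).
have s2 := smooth_at_comp mC mK mG (smooth_at_comp mC mKK mK sv (smooth_at_snd _ mK mK)) (sval _).
have nC : \forall m \near l, src (val (set_val m).1) = tgt (val (set_val m).2).
  by apply: near_all => m; exact: (set_val_in m).
have H := gcomp_smooth_at mM mC s1 s2 nC.
apply: smooth_at_near_eq H => //.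
by apply: near_all => m; apply/esym; exact: (val_bundle_comp (set_val_in m)).
Qed.

Lemma bundle_unit_smooth : @smooth R M K bundle_unit.
Proof.
apply/(smoothP _ mM mK) => x; apply: (smooth_at_into_sub mG mM isotropy_id_embedded).
exact: gunit_smooth_at.
Qed.

Lemma bundle_inv_smooth : @smooth R K K bundle_inv.
Proof.
apply/(smoothP _ mK mK) => k; apply: (smooth_at_into_sub mG mK isotropy_id_embedded).
exact: (smooth_at_comp mK mG mG (sval k) (ginv_smooth_at _)).
Qed.

Definition isotropy_bundle : lieGroupoid M.
Proof.
refine (@LieGroupoid R M K bundle_src bundle_tgt bundle_comp bundle_unit bundle_inv mK bundle_src_submersion
  bundle_tgt_submersion bundle_comp_smooth bundle_unit_smooth bundle_inv_smooth _ _ _ _ _ _ _ _ _ _ _).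
- by move=> h g hg; rewrite /bundle_src val_bundle_comp// src_gcomp.
- by move=> h g hg; rewrite /bundle_tgt val_bundle_comp// tgt_gcomp.
- move=> k h g kh hg; apply: set_val_inj.
  have hgE : bundle_tgt (bundle_comp h g) = bundle_tgt h
    by rewrite /bundle_tgt val_bundle_comp// tgt_gcomp.
  have khE : bundle_src (bundle_comp k h) = bundle_src h
    by rewrite /bundle_src val_bundle_comp// src_gcomp.
  rewrite [LHS]val_bundle_comp ?hgE// [RHS]val_bundle_comp ?khE//.
  by rewrite (val_bundle_comp hg) (val_bundle_comp kh) gcompA.
- by move=> x; exact: src_gunit.
- by move=> x; exact: tgt_gunit.
- move=> g; apply: set_val_inj; rewrite [LHS]val_bundle_comp; first exact: gcomp1g.
  exact: src_gunit.
- move=> g; apply: set_val_inj; rewrite [LHS]val_bundle_comp; first exact: gcompg1.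
  exact: esym (tgt_gunit _ _).
- by move=> g; exact: src_ginv.
- by move=> g; exact: tgt_ginv.
- move=> g; apply: set_val_inj; rewrite [LHS]val_bundle_comp; first exact: gcompVg.
  exact: src_ginv.
- move=> g; apply: set_val_inj; rewrite [LHS]val_bundle_comp; first exact: gcompgV.
  exact: esym (tgt_ginv _).
Defined.

Definition bundle_inclusion : isotropy_bundle -> G := fun k => set_val k.

Lemma bundle_inclusion_range : range bundle_inclusion = A.
Proof.
apply/seteqP; split=> [_ [k _ <-]|g Ag]; first exact: set_val_in.
by exists (exist _ g (mem_set Ag)).
Qed.

Lemma bundle_inclusion_embedding : embedding bundle_inclusion.
Proof.
split.
- split; first by apply/smoothP => // k; exact: sval.
  by move=> c d k ac ad ck dk; exact: (ac.2 _ ad).2.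
- exact: set_val_inj.
- move=> U /open_set_val[V oV <-]; exists V => //.
  rewrite bundle_inclusion_range; apply/seteqP; split=> [_ [k Vk <-]|g [Vg Ag]].
    by split=> //; exact: set_val_in.
  by exists (exist _ g (mem_set Ag)).
Qed.

Lemma bundle_extension : extension bundle_inclusion p.
Proof.
split.
- split=> //.
  + by apply/smoothP => // k; exact: sval.
  + by move=> h g hg; exact: val_bundle_comp.
- split.
  + by apply/smoothP => // g; exact: sp.
  + exact: leaf_proj_src.
  + exact: leaf_proj_tgt.
  + exact: leaf_proj_gunit.
  + exact: leaf_proj_gcomp.
- by apply/seteqP; split=> // l _; exists (leaf_repr l) => //; exact: leaf_reprK.
- exact: set_val_inj.
- rewrite bundle_inclusion_range; apply/seteqP; split=> g.
    by move=> /isotropy_idP gp; exists (src g); rewrite gp.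
  move=> [x px]; apply/isotropy_idP; rewrite px; congr (gunit E _).
  by rewrite -leaf_proj_src px src_gunit.
Qed.

(** The source fibre at [x] is the leaf of the unit at [x], connected in G and therefore in the
    subspace. *)
Lemma bundle_fiber_connected x : connected (src_fiber isotropy_bundle x).
Proof.
have -> : src_fiber isotropy_bundle x =
    @set_val G A @^-1` leaf (@anchor R M G) (gunit G x).
  apply/seteqP; split=> k /=.
    move=> <-; apply/leaf_projP; apply/isotropy_idP; exact: set_val_in.
  by move=> xk; rewrite /src_fiber /= /bundle_src (src_leaf xk) src_gunit.
apply: (@connected_set_val _ A _ (bundle_unit x)); last exact: component_connected.
move=> g xg; apply/isotropy_idP; rewrite (src_leaf xg) src_gunit.
exact/leaf_projP.
Qed.

Lemma leaf_groupoid_foliation : foliation_groupoid E.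
Proof.
move=> x y F l Fl; split; first exact: mem_set.
have [g lE] : exists g, l = p g by exists (leaf_repr l); rewrite /p leaf_reprK.
have [B [oB Bl HB]] := leaf_factor_inj mG mMM (anchor_smooth mM (G := G)) bG g.
exists B; first by rewrite lE; exact: open_nbhs_nbhs.
apply/seteqP; split=> [m [Bm [m1 m2]]|_ ->]; last by split=> //; rewrite lE.
apply: HB => //; first by rewrite lE.
have [l1 l2] := Fl; rewrite /anchor.
by congr pair; [exact: etrans m1 (esym l1)|exact: etrans m2 (esym l2)].
Qed.

End IsotropyBundle.

Theorem proposition2p5 (R : realType) (M : chartedSpace R)
    (M_manifold : is_manifold M) (M_hausdorff : hausdorff_space M)
    (G : lieGroupoid M) (G_regular : regular G) :
  exists (K E : lieGroupoid M) (j : K -> G) (p : G -> E),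
    [/\ extension j p,
        range j = isotropy_id_component G /\ embedding j,
        bundle_of_Lie_groups K /\
          (forall x : M, connected (src_fiber K x)),
        foliation_groupoid E /\ (second_countable G -> second_countable E) &
        submersion p /\ (forall e : E, connected (p @^-1` [set e]))].
Proof.
have bG := anchor_boxed M_manifold G_regular.
have mG := arrows_manifold G; have mMM := prod_manifold M_manifold M_manifold.
have sF := anchor_smooth M_manifold (G := G).
exists (isotropy_bundle M_manifold bG), (leaf_groupoid M_manifold bG),
  (@bundle_inclusion R M M_manifold G bG), (leaf_proj (@anchor R M G)); split.
- exact: bundle_extension.
- split; first exact: bundle_inclusion_range.
  exact: bundle_inclusion_embedding.
- split; first exact: bundle_src_tgt.
  exact: bundle_fiber_connected.
- split; first exact: leaf_groupoid_foliation.
  exact: (leaf_second_countable mG mMM sF bG).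
- split; first exact: (leaf_proj_submersion mG mMM sF bG).
  exact: leaf_proj_fiber_connected.
Qed.
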